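(* Let the sequences be generated by Algorithm 3 (described in the context), assumed not to stop, where each $F_i$ is $L_i$-Lipschitz continuous ($L_i>0$), i.e. $\|F_i(x)-F_i(y)\|\le L_i\|x-y\|$ for all $x,y\in\operatorname{Dom}F_i$, $i=1,\dots,n$. Let $d_{0,\gamma}$ denote the distance, in the norm $\|\cdot\|_\gamma$, of $p^0$ to $\mathcal S_e$, and let $\overline L:=\max_{i=1,\dots,n}L_i$, $\underline L:=\min_{i=1,\dots,n}L_i$. Suppose that $\overline\alpha:=\sup_{k\ge0}\alpha_k<+\infty$ and $\overline s:=\sum_{k=0}^\infty\beta_k^2<+\infty$; put $\overline\beta:=\sup_{k\ge0}\beta_k$ and $$\Omega_{(\alpha,\beta)}:=(1+\overline\alpha)\Big[(1+\overline\beta)\big[1+\overline\alpha(1+\overline\beta)\big]+\overline s\Big].$$ Then: (a) (Strong convergence) With $p^k=(z^k,w_1^k,\dots,w_{n-1}^k)$ and $w_n^k:=-\sum_{i=1}^{n-1}G_i^*w_i^k$, the sequence $(p^k)$ converges strongly to $p^*:=(z^*,w_1^*,\dots,w_{n-1}^* )$, the orthogonal projection (with respect to $\langle\cdot,\cdot\rangle_\gamma$) of $p^0$ onto $\mathcal S_e$; $(z^k)$ converges strongly to $z^*$, which is a solution of $0\in\sum_{i=1}^nG_i^*(F_i+B_i)(G_iz)$; $(w_i^k)$ converges strongly to $w_i^*$ for $1\le i\le n$, where $w_n^*:=-\sum_{i=1}^{n-1}G_i^*w_i^*$; and, for $i=1,\dots,n$, $(x_i^k)$ and $(y_i^k)$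 converge strongly to $G_iz^*$ and $w_i^*$, respectively. (b) (Iteration-complexity) For all $k\ge0$ there exists $\ell\in\{0,1,\dots,k\}$ such that $$y_i^\ell\in(F_i+B_i)(x_i^\ell),\quad i=1,\dots,n,$$ $$\Big\|\sum_{i=1}^{n-1}G_i^*y_i^\ell+y_n^\ell\Big\|\le\frac{n\big(\max_{i=1,\dots,n}\|G_i\|^2\big)\max\big\{\frac{\overline L}{\sigma},\frac{\sigma}{\underline L}\big\}d_{0,\gamma}}{\sqrt{k+1}}\left(\frac{4\sqrt\gamma\max\{1,1/\gamma\}\sqrt{\Omega_{(\alpha,\beta)}}}{1-\sigma^2}\right),$$ $$\|x_i^\ell-G_ix_n^\ell\|\le\frac{n\big(\max_{i=1,\dots,n}\|G_i\|^2\big)\max\big\{\frac{\overline L}{\sigma},\frac{\sigma}{\underline L}\big\}d_{0,\gamma}}{\sqrt{k+1}}\left(\frac{4\max\{1,1/\gamma\}\sqrt{\Omega_{(\alpha,\beta)}}}{1-\sigma^2}\right),\quad i=1,\dots,n-1.$$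
   Context: Setting. Let $n\ge2$, let $\mathcal H_0,\dots,\mathcal H_{n-1}$ be real Hilbert spaces with $\mathcal H_0\neq\{0\}$, and $\mathcal H_n:=\mathcal H_0$; inner products and norms are written $\langle\cdot,\cdot\rangle$ and $\|\cdot\|$. For $i=1,\dots,n$: $F_i:\operatorname{Dom}F_i\subseteq\mathcal H_i\to\mathcal H_i$ is a single-valued continuous monotone map; $B_i:\mathcal H_i\rightrightarrows\mathcal H_i$ is a set-valued maximal monotone operator with $\operatorname{Dom}B_i\subseteq C_i\subseteq\operatorname{Dom}F_i$, where $C_i$ is a nonempty closed convex subset of $\mathcal H_i$; $G_i:\mathcal H_0\to\mathcal H_i$ is a bounded linear operator with adjoint $G_i^*$ and operator norm $\|G_i\|$, and $G_n=I$ is the identity. The problem is to find $z\in\mathcal H_0$ with $0\in\sum_{i=1}^nG_i^*(F_i+B_i)(G_iz)$; it is assumed to have at least one solution. Put $T_i:=F_i+B_i$ (maximal monotone; single-valued maps are identified with set-valued ones, empty outside their domain). For $\gamma>0$, $\boldsymbol{\mathcal H}:=\mathcal H_0\times\dots\times\mathcal H_{n-1}$ carries $\langle (z,w),(z',w')\rangle_\gamma=\gamma\langle z,z'\rangle+\sum_{i=1}^{n-1}\langle w_i,w_i'\rangle$ and $\|p\|_\gamma=\sqrt{\langle p,p\rangle_\gamma}$. $P_C$ denotes orthogonal projection onto a nonempty closed convex set $C$ (for subsets of $\boldsymbol{\mathcal H}$, with respect to $\langle\cdot,\cdot\rangle_\gamma$). The extended-solution set is the (nonempty closed convex) set $$\mathcal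 S_e=\Big\{(z,w_1,\dots,w_{n-1})\in\boldsymbol{\mathcal H}: w_i\in T_i(G_iz),\ i=1,\dots,n-1,\ -\sum_{i=1}^{n-1}G_i^*w_i\in T_n(z)\Big\}.$$ Algorithm 3. Input: $p^{-1}=p^0=(z^0,w_1^0,\dots,w_{n-1}^0)\in\boldsymbol{\mathcal H}$ (so $z^{-1}=z^0$, $w_i^{-1}=w_i^0$), $0<\sigma<1$, $\gamma>0$; set $\lambda_i=\sigma/L_i$ for $i=1,\dots,n$. For $k=0,1,\dots$: (1) Choose $\alpha_k,\beta_k\ge0$ and set $\widehat z^k=z^k+\alpha_k(z^k-z^{k-1})$, $\widetilde z^k=\widehat z^k+\beta_k(\widehat z^k-z^0)$; for $i=1,\dots,n-1$: $\widehat w_i^k=w_i^k+\alpha_k(w_i^k-w_i^{k-1})$, $\widetilde w_i^k=\widehat w_i^k+\beta_k(\widehat w_i^k-w_i^0)$; and $\widetilde w_n^k=-\sum_{i=1}^{n-1}G_i^*\widetilde w_i^k$. (2) For $i=1,\dots,n$, let $\overline z_i^k:=P_{C_i}(G_i\widetilde z^k)$, $x_i^k=(\lambda_iB_i+I)^{-1}\big(G_i\widetilde z^k+\lambda_i\widetilde w_i^k-\lambda_iF_i(\overline z_i^k)\big)$ and $y_i^k=\frac{G_i\widetilde z^k+\lambda_i\widetilde w_i^k-x_i^k}{\lambda_i}+F_i(x_i^k)-F_i(\overline z_i^k)$. (3) If $x_i^k=G_ix_n^k$ for $i=1,\dots,n-1$ and $\sum_{i=1}^{n-1}G_i^*y_i^k+y_n^k=0$,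 stop and return $(x_n^k,y_1^k,\dots,y_{n-1}^k)$. (4) Otherwise let $\varepsilon_i^k:=0$ for $i=1,\dots,n$; let $\varphi_k(p)=\sum_{i=1}^n\big(\langle G_iz-x_i^k,y_i^k-w_i\rangle-\varepsilon_i^k\big)$ for $p=(z,w_1,\dots,w_{n-1})$, with $w_n:=-\sum_{i=1}^{n-1}G_i^*w_i$; let $p^k=(z^k,w_1^k,\dots,w_{n-1}^k)$, $H_k=\{p:\varphi_k(p)\le0\}$, $W_k=\{p:\langle p^0-p^k,p-p^k\rangle_\gamma\le0\}$, and set $p^{k+1}=(z^{k+1},w_1^{k+1},\dots,w_{n-1}^{k+1})=P_{H_k\cap W_k}(p^0)$. *)

(* Defs.v *)
From HB Require Import structures.
From mathcomp Require Import all_boot all_order all_algebra.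
From mathcomp Require Import sesquilinear.
From mathcomp Require Import all_classical all_reals all_analysis.

Set Implicit Arguments.
Unset Strict Implicit.
Unset Printing Implicit Defensive.

Import Order.TTheory GRing.Theory Num.Theory.
Import numFieldNormedType.Exports.

Local Open Scope classical_set_scope.
Local Open Scope ring_scope.

(* A real Hilbert space: a complete normed module whose norm comes from an
   inner product (a positive definite symmetric bilinear form). *)
HB.mixin Record CompleteNormedModule_isHilbert (R : realType) (H : Type)
    of CompleteNormedModule R H := {
  inner : {dot H for @idfun R} ;
  inner_normE : forall x : H, inner x x = `|x| ^+ 2
}.

#[short(type="hilbertType")]
HB.structure Definition Hilbert (R : realType) :=
  {H of CompleteNormedModule R H & CompleteNormedModule_isHilbert R H}.

Section HilbertOperators.
Context {R : realType} {V W : hilbertType R}.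

Definition bounded_operator (f : V -> W) : Prop :=
  exists M : R, forall x, `|f x| <= M * `|x|.

Definition opnorm (f : V -> W) : R :=
  sup [set `|f x| | x in [set x : V | `|x| <= 1]].

Definition is_adjoint (f : V -> W) (g : W -> V) : Prop :=
  forall x y, inner (f x) y = inner x (g y).

End HilbertOperators.

(* Set-valued operators on V are maps V -> set V; a partial single-valued map
   is a total function together with its domain D, its values outside D being
   irrelevant. *)
Section MonotoneOperators.
Context {R : realType} {V : hilbertType R}.
Implicit Types (A B : V -> set V).

Definition monotone_op A : Prop :=
  forall x y u v, A x u -> A y v -> 0 <= inner (x - y) (u - v).

Definition maximal_monotone_op A : Prop :=
  monotone_op A /\
  forall A', monotone_op A' -> (forall x, A x `<=` A' x) ->
    forall x, A' x `<=` A x.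

Definition op_dom A : set V := [set x | A x !=set0].

Definition single_valued (D : set V) (F : V -> V) : V -> set V :=
  fun x => [set u | D x /\ u = F x].

Definition op_add A B : V -> set V :=
  fun x => [set u + v | u in A x & v in B x].

(* The value at u of (lambda B + I)^{-1}. *)
Definition resolvent (lambda : R) B (u : V) : set V :=
  [set x | exists2 b, B x b & lambda *: b + x = u].

Definition extrapolate (a b : R) (u u_prev u0 : V) : V :=
  let hat := u + a *: (u - u_prev) in hat + b *: (hat - u0).

End MonotoneOperators.

(* q = P_S x, relative to the distance dist. *)
Definition is_proj (R : realType) (E : Type) (dist : E -> E -> R)
    (S : set E) (x q : E) : Prop :=
  S q /\ forall y, S y -> dist x q <= dist x y.

(* Indices: i : 'I_n.-1 stands for 1, ..., n-1, and j : option 'I_n.-1 for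
   1, ..., n, where None stands for n.  H i is H_1, ..., H_{n-1}, and
   sp H0 H j is H_1, ..., H_n with H_n = H_0. *)
Section ProductSpace.
Context {R : realType} {n : nat}.
Variables (H0 : hilbertType R) (H : 'I_n.-1 -> hilbertType R).

Definition sp (j : option 'I_n.-1) : hilbertType R :=
  if j is Some i then H i else H0.

(* Points (z, (w_1, ..., w_{n-1})). *)
Definition prodsp : Type := (H0 * (forall i : 'I_n.-1, H i))%type.

Definition psub (p q : prodsp) : prodsp :=
  (p.1 - q.1, fun i => p.2 i - q.2 i).

Definition inner_gamma (gamma : R) (p q : prodsp) : R :=
  gamma * inner p.1 q.1 + \sum_(i < n.-1) inner (p.2 i) (q.2 i).

Definition norm_gamma (gamma : R) (p : prodsp) : R :=
  Num.sqrt (inner_gamma gamma p p).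

Definition dist_gamma (gamma : R) (p q : prodsp) : R :=
  norm_gamma gamma (psub p q).

Section Operators.
Variables (G : forall j, H0 -> sp j) (Gs : forall j, sp j -> H0).
Variables (T : forall j, sp j -> set (sp j)).
Arguments Gs : clear implicits.
Arguments T : clear implicits.

(* (w_1, ..., w_n) with w_n = - sum_{i < n} G_i^* w_i. *)
Definition wfull (p : prodsp) (j : option 'I_n.-1) : sp j :=
  match j return sp j with
  | Some i => p.2 i
  | None => - \sum_(i < n.-1) Gs (Some i) (p.2 i)
  end.

Definition solutions : set H0 :=
  [set z | exists v : forall j, sp j,
     (forall j, T j (G j z) (v j)) /\ \sum_j Gs j (v j) = 0].

Definition extended_solutions : set prodsp :=
  [set p | forall j, T j (G j p.1) (wfull p j)].

Definition phi (x y : forall j, sp j) (eps : option 'I_n.-1 -> R)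
    (p : prodsp) : R :=
  \sum_j (inner (G j p.1 - x j) (y j - wfull p j) - eps j).

End Operators.

Section Algorithm.
Variables (G : forall j, H0 -> sp j) (Gs : forall j, sp j -> H0).
Variables (F : forall j, sp j -> sp j) (B : forall j, sp j -> set (sp j)).
Variables (C : forall j, set (sp j)).
Arguments C : clear implicits.
Arguments Gs : clear implicits.
Arguments F : clear implicits.
Arguments B : clear implicits.
Variables (lambda : option 'I_n.-1 -> R) (gamma : R) (alpha beta : nat -> R).
Variables (p : nat -> prodsp) (zbar x y : nat -> forall j, sp j).

(* Since 0.-1 = 0, the convention p^{-1} = p^0 is built in. *)
Definition ptilde (k : nat) : prodsp :=
  (extrapolate (alpha k) (beta k) (p k).1 (p k.-1).1 (p 0%N).1,
   fun i => extrapolate (alpha k) (beta k) ((p k).2 i) ((p k.-1).2 i)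
              ((p 0%N).2 i)).

Definition Hk (k : nat) : set prodsp :=
  [set q | phi G Gs (x k) (y k) (fun _ => 0) q <= 0].

Definition Wk (k : nat) : set prodsp :=
  [set q | inner_gamma gamma (psub (p 0%N) (p k)) (psub q (p k)) <= 0].

Definition stops_at (k : nat) : Prop :=
  (forall i : 'I_n.-1, x k (Some i) = G (Some i) (x k None)) /\
  \sum_(i < n.-1) Gs (Some i) (y k (Some i)) + y k None = 0 :> H0.

Record generated_sequences : Prop := GeneratedSequences {
  alpha_ge0 : forall k, 0 <= alpha k ;
  beta_ge0 : forall k, 0 <= beta k ;
  zbar_def : forall k j,
    is_proj (fun u v : sp j => `|u - v|) (C j)
      (G j (ptilde k).1) (zbar k j) ;
  x_def : forall k j,
    resolvent (lambda j) (B j)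
      (G j (ptilde k).1 + lambda j *: wfull Gs (ptilde k) j
         - lambda j *: F j (zbar k j))
      (x k j) ;
  y_def : forall k j,
    y k j = (lambda j)^-1 *: (G j (ptilde k).1
                + lambda j *: wfull Gs (ptilde k) j - x k j)
            + F j (x k j) - F j (zbar k j) ;
  never_stops : forall k, ~ stops_at k ;
  p_next : forall k,
    is_proj (dist_gamma gamma) (Hk k `&` Wk k) (p 0%N) (p k.+1)
}.

End Algorithm.
End ProductSpace.

Definition Omega (R : realType) (alpha beta : nat -> R) : R :=
  let a := sup (range alpha) in
  let b := sup (range beta) in
  let s := limn (series (fun k => beta k ^+ 2)) in
  (1 + a) * ((1 + b) * (1 + a * (1 + b)) + s).

(* Main.v *)
Require Import Defs.
From HB Require Import structures.
From mathcomp Require Import all_boot all_order all_algebra.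
From mathcomp Require Import sesquilinear.
From mathcomp Require Import all_classical all_reals all_analysis.
From mathcomp Require Import ring lra.

(** Every pair of graph points [(x_j, y_j)] of the monotone operators
    [T_j = F_j + B_j] gives the function [phi G Gs x y], which is affine in
    [p = (z, w)]: its bilinear terms [<G_j z, w_j>] add up to
    [<z, sum_j Gs_j w_j> = 0] ([phi_affine]).  By monotonicity it is nonpositive
    on the extended-solution set, and by maximality of the [T_j] the extended
    solutions are exactly the points where all these functions are nonpositive
    ([extended_of_phi_le0]).  An iteration projects [p 0] onto the intersection
    of one such half-space with the half-space [Wk], in the manner of Haugazeau.

    Complexity.  The Lipschitz bound makes the forward-backward step an
    approximate resolvent step, so [phi] is large at the extrapolated point
    [ptilde] compared with the squared residuals
    ([forward_backward_estimate]), while the gradient of [phi] is controlled by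
    the same residuals ([phi_grad_le]).  As [phi] is nonpositive at the next
    iterate, Cauchy-Schwarz bounds the gradient, whose components are the two
    quantities of the theorem, by the displacement from [ptilde k] to
    [p k.+1] ([step_bounds]).  The squared displacements have a sum of at most
    [Omega * d0 ^ 2] ([extrapolation_sum]): in Haugazeau's scheme the squared
    distances to [p 0] grow at least by the squared steps and stay below
    [d0 ^ 2].  The smallest of the first [k + 1] terms is at most the average.

    Convergence.  The displacements, hence the residuals, tend to [0], so the
    upper limit of [phi] along the iterates is nonpositive for each choice of
    graph points ([phi_eventually_le]).  The usual argument would pass to weak
    cluster points; here the role of weak compactness is played by nested closed
    convex sets.  [tail m] is the set of points at which each [phi] is at most
    its supremum over the iterates from the [m]-th on.  These sets decrease,
    contain the iterates, and their intersection lies in the extended-solution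
    set.  The distances from [p 0] to them increase to the distance to a point
    of the intersection, and since no iterate is farther from [p 0] than that
    point, the parallelogram law makes the iterates converge to it
    ([nested_convex_cvg]).

    Maximality of [F_j + B_j] rests on the surjectivity of [I + lambda B_j]
    (Minty's theorem, [minty]), which turns the question into a fixed point of
    a contraction ([sum_maximal]). *)

Set Implicit Arguments.
Unset Strict Implicit.
Unset Printing Implicit Defensive.

Import Order.TTheory GRing.Theory Num.Theory.
Import numFieldNormedType.Exports.

Local Open Scope classical_set_scope.
Local Open Scope ring_scope.

(** * Real sequences and one-variable inequalities *)

Section RealLemmas.
Context {R : realType}.
Implicit Types (a b c e : R).

(** The first-order condition at the endpoint of a segment: [a] is the one-sided
    derivative of a function that is minimal at [s = 0]. *)
Lemma ge0_of_quadratic a b :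
  (forall s, 0 < s -> s <= 1 -> 0 <= s * a + s ^+ 2 * b) -> 0 <= a.
Proof.
move=> H; rewrite leNgt; apply/negP => a0.
have nb : 0 <= `|b| by [].
have d0 : 0 < `|b| - a by lra.
(* At most [1] and at most half of [- a / `|b|], where the quadratic with
   coefficient [`|b|] vanishes. *)
pose s := - a / (2 * (`|b| - a)).
have s0 : 0 < s by rewrite divr_gt0 //; lra.
have s1 : s <= 1 by rewrite ler_pdivrMr; lra.
have sd : s * (2 * (`|b| - a)) = - a by rewrite mulfVK // gt_eqF //; lra.
have := H s s0 s1; have -> : s * a + s ^+ 2 * b = s * (a + s * b) by ring.
rewrite pmulr_rge0 // => h.
have hb : s * b <= s * `|b| by rewrite ler_pM2l // ler_norm.
nra.
Qed.

Lemma cvg0N (x : nat -> R) :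
  x k @[k --> \oo] --> 0 -> - x k @[k --> \oo] --> 0.
Proof. by move=> /cvgN; rewrite oppr0; exact. Qed.

Lemma cvg0Z (c : R) (x : nat -> R) :
  x k @[k --> \oo] --> 0 -> c * x k @[k --> \oo] --> 0.
Proof.
by move=> x0; rewrite -(mulr0 c); apply: cvgM x0; exact: cvg_cst.
Qed.

Lemma cvg0D (x z : nat -> R) : x k @[k --> \oo] --> 0 ->
  z k @[k --> \oo] --> 0 -> x k + z k @[k --> \oo] --> 0.
Proof. by move=> x0 z0; have := cvgD x0 z0; rewrite addr0; exact. Qed.

(** Inner products against a null sequence are controlled through their squares,
    which is the form in which Cauchy-Schwarz is available. *)
Lemma cvg0_sqr_le (c : R) (e x : nat -> R) :
  (forall k, x k ^+ 2 <= c * e k) -> e k @[k --> \oo] --> 0 ->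
  x k @[k --> \oo] --> 0.
Proof.
move=> xe e0; apply/norm_cvg0P.
have h : Num.sqrt (c * e k) @[k --> \oo] --> (0:R).
  have := cvg_comp _ _ (cvg0Z c e0) (@sqrt_continuous R 0); rewrite sqrtr0; exact.
apply: (@squeeze_cvgr _ _ _ _ (fun=> 0) (fun k => Num.sqrt (c * e k))) => //.
  by near=> k; rewrite normr_ge0/= -sqrtr_sqr ler_wsqrtr.
exact: cvg_cst.
Unshelve. all: by end_near. Qed.

Lemma cvg0_le (e x : nat -> R) :
  (forall k, 0 <= x k <= e k) -> e k @[k --> \oo] --> 0 ->
  x k @[k --> \oo] --> 0.
Proof.
move=> xe e0; apply: (@squeeze_cvgr _ _ _ _ (fun=> 0) e) => //.
  by near=> k; exact: xe.
exact: cvg_cst.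
Unshelve. all: by end_near. Qed.

Lemma cvg0_eventually_le (x : nat -> R) e : 0 < e -> x k @[k --> \oo] --> 0 ->
  exists N, forall k, (N <= k)%N -> x k <= e.
Proof.
move=> e0 /cvgr0Pnorm_le/(_ e e0)[N _ HN]; exists N => k Nk.
by apply: le_trans (HN k Nk); exact: ler_norm.
Qed.

Lemma eventually_le_cvg0 (x : nat -> R) : (forall k, 0 <= x k) ->
  (forall e : R, 0 < e -> exists N, forall k, (N <= k)%N -> x k <= e) ->
  x k @[k --> \oo] --> 0.
Proof.
move=> x0 H; apply/cvgr0Pnorm_le => e /H[N HN]; exists N => // k /= Nk.
by rewrite ger0_norm // HN.
Qed.

Lemma cvg0_sum (I : finType) (x : I -> nat -> R) :
  (forall i, x i k @[k --> \oo] --> 0) -> \sum_i x i k @[k --> \oo] --> 0.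
Proof.
move=> H; elim: (index_enum I) => [|i s IHs].
  by under eq_cvg do rewrite big_nil; exact: cvg_cst.
under eq_cvg do rewrite big_cons.
exact: cvg0D.
Qed.

Lemma bounded_sum_cvg0 (a : nat -> R) (D : R) : (forall k, 0 <= a k) ->
  (forall k, \sum_(0 <= l < k) a l <= D) -> a k @[k --> \oo] --> 0.
Proof.
move=> a0 aD; apply: cvg_series_cvg_0; apply: nondecreasing_is_cvgn.
  by apply/nondecreasing_seqP => k; rewrite /series /= big_nat_recr //= lerDl.
by exists D => _ [k _ <-]; exact: aD.
Qed.

Lemma sum_le_limn (a : nat -> R) k : (forall k, 0 <= a k) ->
  cvgn (series a) -> \sum_(0 <= l < k) a l <= limn (series a).
Proof.
move=> a0 ac; have := @nondecreasing_cvgn_le R (series a) _ ac k.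
apply.
by apply/nondecreasing_seqP => m; rewrite /series /= big_nat_recr //= lerDl.
Qed.

Lemma exists_le_average (a : nat -> R) (D : R) k :
  \sum_(0 <= l < k.+1) a l <= D ->
  exists2 l, (l <= k)%N & a l <= D / k.+1%:R.
Proof.
move=> aD; apply: contrapT => H.
have ha l : (l < k.+1)%N -> D / k.+1%:R < a l.
  by move=> lk; rewrite ltNge; apply/negP => h; apply: H; exists l.
have : \sum_(0 <= l < k.+1) (D / k.+1%:R) < \sum_(0 <= l < k.+1) a l.
  rewrite !big_mkord; apply: ltr_sum => [|i _]; last exact: ha.
  by apply/hasP; exists ord0 => //; exact: mem_index_enum.
rewrite sumr_const_nat subn0 -[_ *+ _]mulr_natr divfK ?pnatr_eq0 //.
by rewrite ltNge aD.
Qed.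

End RealLemmas.

(** * Complete semidefinite forms *)

Lemma mid_segment (R : realType) (E : lmodType R) (u v : E) :
  2^-1 *: (u + v) = u + 2^-1 *: (v - u).
Proof.
rewrite scalerDr scalerBr [RHS]addrCA addrC; congr (_ + _).
apply/eqP; rewrite eq_sym subr_eq -scalerDl.
have -> : 2^-1 + 2^-1 = 1 :> R by lra.
by rewrite scale1r.
Qed.


(** Convergence is measured by the squared seminorm, so that it makes sense for
    a form on a module that carries no topology. *)
Definition form_cvg (R : realType) (E : lmodType R) (ip : E -> E -> R)
    (u : nat -> E) (l : E) : Prop :=
  ip (u k - l) (u k - l) @[k --> \oo] --> 0.

(** A complete positive semidefinite form on a bare module.  The same arguments
    are needed in the given Hilbert spaces, in [V * V] (for Minty's theorem) and
    in the product space with the weight [gamma]; stating them for such forms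
    avoids building a topology on each product. *)
Record hilbert_form (R : realType) (E : lmodType R) (ip : E -> E -> R) :
    Prop := HilbertForm {
  form_linear : forall a u v w, ip (a *: u + v) w = a * ip u w + ip v w ;
  form_sym : forall u v, ip u v = ip v u ;
  form_ge0 : forall u, 0 <= ip u u ;
  form_complete : forall u : nat -> E,
    (forall e : R, 0 < e -> exists N, forall m k, (N <= m)%N -> (N <= k)%N ->
       ip (u m - u k) (u m - u k) <= e) ->
    exists l, form_cvg ip u l }.

Section HilbertFormTheory.
Context {R : realType} {E : lmodType R} {ip : E -> E -> R}.
Hypothesis hip : hilbert_form ip.
Implicit Types (u v w : E) (a : R).

Lemma ipDl u v w : ip (u + v) w = ip u w + ip v w.
Proof. by rewrite -[u]scale1r (form_linear hip) mul1r scale1r. Qed.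

Lemma ip0l w : ip 0 w = 0.
Proof. by have := ipDl 0 0 w; rewrite addr0; lra. Qed.

Lemma ipZl a u w : ip (a *: u) w = a * ip u w.
Proof. by rewrite -[a *: u]addr0 (form_linear hip) ip0l addr0. Qed.

Lemma ipNl u w : ip (- u) w = - ip u w.
Proof. by rewrite -scaleN1r ipZl mulN1r. Qed.

Lemma ipDr u v w : ip w (u + v) = ip w u + ip w v.
Proof. by rewrite !(form_sym hip w) ipDl. Qed.

Lemma ipZr a u w : ip w (a *: u) = a * ip w u.
Proof. by rewrite !(form_sym hip w) ipZl. Qed.

Lemma ipNr u w : ip w (- u) = - ip w u.
Proof. by rewrite !(form_sym hip w) ipNl. Qed.

Lemma ip0r w : ip w 0 = 0.
Proof. by rewrite (form_sym hip) ip0l. Qed.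

Definition ipE := (ipDl, ipDr, ipNl, ipNr, ipZl, ipZr, ip0l, ip0r).

Lemma ip_suml (I : finType) (F : I -> E) w :
  ip (\sum_i F i) w = \sum_i ip (F i) w.
Proof. exact: (big_morph (ip^~ w) (fun u v => ipDl u v w) (ip0l w)). Qed.

Lemma ip_sumr (I : finType) (F : I -> E) w :
  ip w (\sum_i F i) = \sum_i ip w (F i).
Proof.
by rewrite (form_sym hip) ip_suml; under eq_bigr do rewrite (form_sym hip).
Qed.

(** The form may vanish on nonzero vectors, hence the separate case
    [ip v v = 0], in which the quadratic degenerates to an affine function. *)
Lemma cauchy_schwarz u v : ip u v ^+ 2 <= ip u u * ip v v.
Proof.
have quad t : 0 <= ip u u - 2 * t * ip u v + t ^+ 2 * ip v v.
  have := form_ge0 hip (u - t *: v); rewrite !ipE (form_sym hip v u).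
  by congr (_ <= _); ring.
have [v0|v0] := eqVneq (ip v v) 0.
  rewrite v0 mulr0; have [->|uv0] := eqVneq (ip u v) 0; first by rewrite expr0n.
  have := quad ((ip u u + 1) / (2 * ip u v)); rewrite v0 mulr0 addr0.
  have -> : 2 * ((ip u u + 1) / (2 * ip u v)) * ip u v = ip u u + 1.
    by field; rewrite uv0.
  lra.
have vp : 0 < ip v v by rewrite lt_neqAle eq_sym v0 (form_ge0 hip).
have := quad (ip u v / ip v v).
have -> : ip u u - 2 * (ip u v / ip v v) * ip u v
    + (ip u v / ip v v) ^+ 2 * ip v v
  = (ip u u * ip v v - ip u v ^+ 2) / ip v v by field.
by rewrite pmulr_lge0 ?invr_gt0 // subr_ge0.
Qed.

Lemma ip_sqD_le u v : ip (u + v) (u + v) <= 2 * ip u u + 2 * ip v v.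
Proof.
have := form_ge0 hip (u - v); rewrite !ipE (form_sym hip v u); lra.
Qed.

Lemma sq_oppB u v : ip (u - v) (u - v) = ip (v - u) (v - u).
Proof. by rewrite -(opprB v u) ipNl ipNr opprK. Qed.


(** The difference of the two sides is [#|I|] times the sum of the squared
    deviations of the [F i] from their mean. *)
Lemma sum_sq_le (I : finType) (F : I -> E) :
  ip (\sum_i F i) (\sum_i F i) <= #|I|%:R * \sum_i ip (F i) (F i).
Proof.
set S := \sum_i F i; set N : R := #|I|%:R.
have [I0|I0] := eqVneq N 0.
  have /eqP cI : #|I| == 0%N by rewrite -(pnatr_eq0 R) -/N I0.
  have -> : S = 0.
    by rewrite /S big_pred0 // => i; have := fintype0 i cI.
  by rewrite ip0l I0 mul0r.
have Np : 0 < N by rewrite lt_neqAle eq_sym I0 ler0n.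
have h : 0 <= \sum_i ip (F i - N^-1 *: S) (F i - N^-1 *: S).
  by apply: sumr_ge0 => i _; exact: (form_ge0 hip).
have hE : \sum_i ip (F i - N^-1 *: S) (F i - N^-1 *: S)
    = \sum_i ip (F i) (F i) - N^-1 * ip S S.
  transitivity (\sum_i (ip (F i) (F i) + (- (2 * N^-1) * ip (F i) S
      + N^-1 ^+ 2 * ip S S))).
    by apply: eq_bigr => i _; rewrite !ipE (form_sym hip S (F i)); ring.
  rewrite !big_split/= -mulr_sumr -ip_suml -/S sumr_const -[_ *+ _]mulr_natl.
  by rewrite -/N; field.
by move: h; rewrite hE subr_ge0 mulrC ler_pdivrMr // mulrC.
Qed.

Lemma parallelogram_mid u v w :
  ip (u - v) (u - v) = 2 * ip (u - w) (u - w) + 2 * ip (v - w) (v - w)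
   - 4 * ip (2^-1 *: (u + v) - w) (2^-1 *: (u + v) - w).
Proof.
rewrite !ipE (form_sym hip v u) (form_sym hip w u) (form_sym hip w v); lra.
Qed.

Lemma form_cvg_ip v l (s : nat -> E) : form_cvg ip s l ->
  ip v (s k - l) @[k --> \oo] --> 0.
Proof.
by apply: cvg0_sqr_le => k; exact: cauchy_schwarz.
Qed.

Definition form_closed (K : set E) : Prop :=
  forall (s : nat -> E) l, (forall k, K (s k)) -> form_cvg ip s l -> K l.

Definition midconvex (K : set E) : Prop :=
  forall u v, K u -> K v -> K (2^-1 *: (u + v)).

(** A substitute for weak compactness.  Near-minimizers of the distance from [a]
    to [K m] form a Cauchy sequence, by the parallelogram law at their midpoints,
    which stay in the convex sets; the limit is a common point whose distance to
    [a] is the limit of the distances from [a] to the [K m]. *)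
Lemma nested_convex_inter (K : nat -> set E) (a : E) (D : R) (p : nat -> E) :
  (forall m k, (m <= k)%N -> K k `<=` K m) ->
  (forall m, midconvex (K m)) -> (forall m, form_closed (K m)) ->
  (forall m, K m (p m)) -> (forall m, ip (p m - a) (p m - a) <= D) ->
  exists2 q, (forall m, K m q) &
    forall e : R, 0 < e -> exists N, forall r, K N r ->
      ip (q - a) (q - a) <= ip (r - a) (r - a) + e.
Proof.
move=> Kn Kc Kcl Kp pD.
pose N u : R := ip (u - a) (u - a).
pose A m := [set N r | r in K m].
have A0 m : has_inf (A m).
  split; first by exists (N (p m)), (p m).
  by exists 0 => _ [r _ <-]; exact: (form_ge0 hip).
have infle m r : K m r -> inf (A m) <= N r.
  by move=> Kr; apply: ge_inf; [exact: (A0 m).2 | exists r].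
have S0 : has_sup (range (fun m => inf (A m))).
  split; first by exists (inf (A 0%N)), 0%N.
  exists D => _ [m _ <-]; exact: le_trans (infle _ _ (Kp m)) (pD m).
set S : R := sup (range (fun m => inf (A m))).
have leS m : inf (A m) <= S by apply: ub_le_sup; [exact: S0.2 | exists m].
have ltS (e : R) : 0 < e -> exists M, forall r, K M r -> S <= N r + e.
  move=> e0; have [_ [M _ <-] hM] := sup_adherent e0 S0; exists M => r Kr.
  by rewrite -lerBlDr; exact: le_trans (ltW hM) (infle _ _ Kr).
have [h h0 invN] : exists2 h : nat -> R, (forall m, 0 < h m) &
    forall e : R, 0 < e -> exists M, forall m, (M <= m)%N -> h m <= e.
  exists (fun m => m.+1%:R^-1) => [m|e e0]; first by rewrite invr_gt0.
  by apply: cvg0_eventually_le => //; exact: cvg_harmonic.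
have rex m : exists r, K m r /\ N r <= S + h m.
  have [_ [r Kr <-] hr] := inf_adherent (h0 m) (A0 m).
  exists r; split=> //; apply: (le_trans (ltW hr)); by rewrite lerD2r.
have [r Hr] := choice rex.
have [|q rq] := form_complete hip (u := r).
  move=> e e0; have e8 : 0 < e / 8 by rewrite divr_gt0.
  have [M1 H1] := ltS _ e8; have [M2 H2] := invN _ e8.
  exists (maxn M1 M2) => m k; rewrite !geq_max => /andP[m1 m2] /andP[k1 k2].
  have Kmid := Kc M1 _ _ (Kn _ _ m1 _ (Hr m).1) (Kn _ _ k1 _ (Hr k).1).
  rewrite (parallelogram_mid _ _ a).
  have := H1 _ Kmid; have := (Hr m).2; have := (Hr k).2.
  have := H2 _ m2; have := H2 _ k2; rewrite /N; lra.
have Kq m : K m q.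
  apply: (Kcl m (fun k => r (k + m)%N) q).
    by move=> k; apply: (Kn m (k + m)%N); [exact: leq_addl | exact: (Hr _).1].
  have := rq; rewrite /form_cvg => rq'.
  exact: (cvg_comp (addn^~ m) (fun k => ip (r k - q) (r k - q)) (cvg_addnr m)).
exists q => // e e0; have e4 : 0 < e / 4 by rewrite divr_gt0.
have [M HM] := ltS _ e4; exists M => t Kt.
have [M1 H1] := cvg0_eventually_le e4 (form_cvg_ip (a - q) rq).
have [M2 H2] := invN _ e4.
pose k := maxn M1 M2.
have k1 := H1 k (leq_maxl _ _); have k2 := H2 k (leq_maxr _ _).
have := HM t Kt; have := (Hr k).2.
have := form_ge0 hip (r k - q); move: k1; rewrite /N !ipE.
rewrite (form_sym hip a q) (form_sym hip (r k) q) (form_sym hip (r k) a).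
rewrite (form_sym hip t a).
lra.
Qed.

End HilbertFormTheory.

(** * Projections onto convex sets *)

Section Projection.
Context {R : realType} {E : lmodType R} {ip : E -> E -> R}.
Hypothesis hip : hilbert_form ip.

(** The midpoint of [p k] and the common point [q] nearest to [a] lies in [K N],
    so it is almost as far from [a] as [q]; as [p k] is no farther from [a] than
    [q], the parallelogram law forces [p k] to be close to [q]. *)
Lemma nested_convex_cvg (K : nat -> set E) (a : E) (D : R) (p : nat -> E) :
  (forall m k, (m <= k)%N -> K k `<=` K m) ->
  (forall m, midconvex (K m)) -> (forall m, form_closed (ip := ip) (K m)) ->
  (forall m, K m (p m)) -> (forall m, ip (p m - a) (p m - a) <= D) ->
  (forall q, (forall m, K m q) ->
     forall m, ip (p m - a) (p m - a) <= ip (q - a) (q - a)) ->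
  exists2 q, (forall m, K m q) & form_cvg ip p q.
Proof.
move=> Kn Kc Kcl Kp pD pq.
have [q Kq qmin] := nested_convex_inter hip Kn Kc Kcl Kp pD.
exists q => //; apply: eventually_le_cvg0 => [k|e e0]; first exact: form_ge0.
have e4 : 0 < e / 4 by rewrite divr_gt0.
have [N HN] := qmin _ e4; exists N => k Nk.
have := HN _ (Kc _ _ _ (Kn _ _ Nk _ (Kp k)) (Kq N)); have := pq q Kq k.
rewrite (parallelogram_mid hip (p k) q a); lra.
Qed.

Lemma proj_variational (S : set E) (a q : E) :
  (forall u v s, 0 <= s -> s <= 1 -> S u -> S v -> S (u + s *: (v - u))) ->
  S q -> (forall y, S y -> ip (a - q) (a - q) <= ip (a - y) (a - y)) ->
  forall y, S y -> ip (a - q) (y - q) <= 0.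
Proof.
move=> Sc Sq qmin y Sy.
suff : 0 <= - (2 * ip (a - q) (y - q)) by lra.
apply: (@ge0_of_quadratic R _ (ip (y - q) (y - q))) => s s0 s1.
have := qmin _ (Sc q y s (ltW s0) s1 Sq Sy).
have -> : a - (q + s *: (y - q)) = (a - q) + (- s) *: (y - q).
  by rewrite opprD addrA scaleNr.
move: (a - q) (y - q) => u v; rewrite !(ipE hip) (form_sym hip v u).
by rewrite -subr_ge0; congr (_ <= _); ring.
Qed.

End Projection.

(** * Hilbert spaces and their weighted products *)

Section Hilbert.
Context {R : realType} {V : hilbertType R}.

Lemma form_cvg_inner (u : nat -> V) (l : V) :
  form_cvg (@inner R V) u l <-> u k @[k --> \oo] --> l.
Proof.
split=> H.
  apply/subr_cvg0/norm_cvg0P; apply: (@cvg0_sqr_le _ 1 _ _ _ H) => k.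
  by rewrite mul1r inner_normE.
have : `|u k - l| @[k --> \oo] --> 0 by apply/norm_cvg0P/subr_cvg0.
rewrite /form_cvg => h; rewrite -(mulr0 0).
under eq_fun do rewrite inner_normE expr2.
exact: cvgM.
Qed.

Lemma hilbert_form_inner : hilbert_form (@inner R V).
Proof.
split=> [a u v w|u v|u|u Cu].
- by rewrite linearDl linearZl.
- by rewrite hermC expr0 mul1r.
- by rewrite inner_normE sqr_ge0.
have /cauchy_cvg cu : cauchy (u @ \oo).
  apply: cauchy_exP => e e0; have e2 : 0 < (e / 2) ^+ 2 by rewrite exprn_gt0 ?divr_gt0.
  have [N HN] := Cu _ e2; exists (u N); exists N => // k /= Nk.
  rewrite -ball_normE/=; have := HN N k (leqnn _) Nk.
  rewrite inner_normE ler_sqr ?nnegrE ?divr_ge0 ?(ltW e0) // => h.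
  by apply: (le_lt_trans h); rewrite ltr_pdivrMr // mulr_natr mulr2n ltrDl.
by exists (lim (u @ \oo)); apply/form_cvg_inner.
Qed.

Lemma inner_cvg_le (u : nat -> V) l (c : R) (e : nat -> R) :
  (forall k, inner (u k - l) (u k - l) <= c * e k) ->
  e k @[k --> \oo] --> 0 -> u k @[k --> \oo] --> l.
Proof.
move=> ue e0; apply/form_cvg_inner; apply: (@cvg0_le _ (fun k => c * e k)).
  by move=> k; rewrite ue (form_ge0 hilbert_form_inner).
exact: cvg0Z.
Qed.


End Hilbert.

Section PairForm.
Context {R : realType} {E1 E2 : lmodType R}.
Context {ip1 : E1 -> E1 -> R} {ip2 : E2 -> E2 -> R}.
Hypotheses (h1 : hilbert_form ip1) (h2 : hilbert_form ip2).

Definition form_pair (g : R) (p q : E1 * E2) : R :=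
  g * ip1 p.1 q.1 + ip2 p.2 q.2.

Lemma hilbert_form_pair g : 0 < g -> hilbert_form (form_pair g).
Proof.
move=> g0; have q1 u := form_ge0 h1 u; have q2 u := form_ge0 h2 u.
have gq1 u : 0 <= g * ip1 u u by rewrite mulr_ge0 // ltW.
split=> [a u v w|u v|u|u Cu]; rewrite /form_pair /=.
- by rewrite (form_linear h1) (form_linear h2); ring.
- by rewrite (form_sym h1) (form_sym h2).
- exact: addr_ge0.
have [|l1 L1] := form_complete h1 (u := fst \o u).
  move=> e e0; have ge0 : 0 < g * e by rewrite mulr_gt0.
  have [N HN] := Cu _ ge0; exists N => m k Nm Nk.
  rewrite -(ler_pM2l g0); apply: le_trans (HN m k Nm Nk).
  by rewrite /form_pair /= lerDl.
have [|l2 L2] := form_complete h2 (u := snd \o u).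
  move=> e e0; have [N HN] := Cu _ e0; exists N => m k Nm Nk.
  by apply: le_trans (HN m k Nm Nk); rewrite /form_pair /= lerDr.
exists (l1, l2); rewrite /form_cvg /form_pair /=.
by apply: cvg0D => //; exact: cvg0Z.
Qed.

End PairForm.
Arguments form_pair {R E1 E2} ip1 ip2 g p q.

(** A separate name for the dependent product, so that it can be given a module
    structure of its own while remaining convertible to the product used for the
    [w]-components of the algorithm. *)
Definition dprod (I : Type) (R : realType) (V : I -> lmodType R) : Type :=
  forall i, V i.

HB.instance Definition _ (I : Type) (R : realType) (V : I -> lmodType R) :=
  gen_eqMixin (dprod V).
HB.instance Definition _ (I : Type) (R : realType) (V : I -> lmodType R) :=
  gen_choiceMixin (dprod V).

Section DprodLmodule.
Context (I : Type) (R : realType) (V : I -> lmodType R).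
Implicit Types u v w : dprod V.

Definition dprod_zero : dprod V := fun i => 0.
Definition dprod_opp u : dprod V := fun i => - u i.
Definition dprod_add u v : dprod V := fun i => u i + v i.
Definition dprod_scale (a : R) u : dprod V := fun i => a *: u i.

Fact dprod_addA : associative dprod_add.
Proof. by move=> u v w; apply: functional_extensionality_dep => i; exact: addrA. Qed.
Fact dprod_addC : commutative dprod_add.
Proof. by move=> u v; apply: functional_extensionality_dep => i; exact: addrC. Qed.
Fact dprod_add0 : left_id dprod_zero dprod_add.
Proof. by move=> u; apply: functional_extensionality_dep => i; exact: add0r. Qed.
Fact dprod_addN : left_inverse dprod_zero dprod_opp dprod_add.
Proof. by move=> u; apply: functional_extensionality_dep => i; exact: addNr. Qed.

HB.instance Definition _ := GRing.isZmodule.Build (dprod V)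
  dprod_addA dprod_addC dprod_add0 dprod_addN.

Fact dprod_scaleA a b u : dprod_scale a (dprod_scale b u) = dprod_scale (a * b) u.
Proof. by apply: functional_extensionality_dep => i; exact: scalerA. Qed.
Fact dprod_scale1 : left_id 1 dprod_scale.
Proof. by move=> u; apply: functional_extensionality_dep => i; exact: scale1r. Qed.
Fact dprod_scaleDr : right_distributive dprod_scale +%R.
Proof. by move=> a u v; apply: functional_extensionality_dep => i; exact: scalerDr. Qed.
Fact dprod_scaleDl u : {morph dprod_scale^~ u : a b / a + b}.
Proof. by move=> a b; apply: functional_extensionality_dep => i; exact: scalerDl. Qed.

HB.instance Definition _ := GRing.Zmodule_isLmodule.Build R (dprod V)
  dprod_scaleA dprod_scale1 dprod_scaleDr dprod_scaleDl.

End DprodLmodule.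

Section DprodForm.
Context {R : realType} {I : finType} {V : I -> lmodType R}.
Context {ip : forall i, V i -> V i -> R}.
Hypothesis hip : forall i, hilbert_form (@ip i).

Definition form_dprod (u v : dprod V) : R := \sum_i ip (u i) (v i).

Lemma hilbert_form_dprod : hilbert_form form_dprod.
Proof.
split=> [a u v w|u v|u|u Cu].
- rewrite /form_dprod mulr_sumr -big_split; apply: eq_bigr => i _ /=.
  exact: form_linear.
- by apply: eq_bigr => i _; exact: form_sym.
- by apply: sumr_ge0 => i _; exact: form_ge0.
have [l Hl] : exists l : dprod V, forall i, form_cvg (@ip i) (u ^~ i) (l i).
  suff H i : exists li, form_cvg (@ip i) (u ^~ i) li.
    by exists (fun i => projT1 (cid (H i))) => i; exact: projT2 (cid (H i)).
  apply: form_complete => // e e0; have [N HN] := Cu _ e0.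
  exists N => m k Nm Nk; apply: le_trans (HN m k Nm Nk).
  rewrite /form_dprod (bigD1 i) //= lerDl.
  by apply: sumr_ge0 => j _; exact: form_ge0.
exists l; rewrite /form_cvg /form_dprod.
by apply: cvg0_sum => i; exact: Hl.
Qed.

End DprodForm.
Arguments form_dprod {R I V} ip u v.

(** * Maximal monotone operators *)

Section FormMonotone.
Context {R : realType} {V : lmodType R} {ip : V -> V -> R}.
Hypothesis hip : hilbert_form ip.
Hypothesis ip0 : forall u, ip u u <= 0 -> u = 0.
Implicit Types (A B : V -> set V).

Definition form_monotone B := forall x y u v, B x u -> B y v ->
  0 <= ip (x - y) (u - v).

Definition form_maximal B := form_monotone B /\
  forall x w, (forall u b, B u b -> 0 <= ip (x - u) (w - b)) -> B x w.

Lemma maximal_monotone_nonempty B : form_maximal B ->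
  exists u b, B u b.
Proof.
move=> Bmax; apply: contrapT => nB.
have B0 u b : ~ B u b by move=> Bu; apply: nB; exists u, b.
apply: (B0 0 0); by apply: Bmax.2 => u b /B0 [].
Qed.

Lemma maximal_monotone_inf B x w e : form_maximal B -> 0 < e ->
  exists u b, B u b /\ ip (x - u) (w - b) <= e.
Proof.
move=> Bmax e0; apply: contrapT => nB.
have H u b : B u b -> e < ip (x - u) (w - b).
  by move=> Bu; rewrite ltNge; apply/negP => h; apply: nB; exists u, b.
have := Bmax.2 _ _ (fun u b Bu => ltW (lt_trans e0 (H u b Bu))).
by move=> /H; rewrite !subrr (ip0l hip) ltNge ltW.
Qed.

Local Notation ipP := (form_pair ip ip 1).

(** Minty's theorem at [0], by Fitzpatrick's function
    [h (x, w) = sup_(u, b) (<x, b> + <u, w> - <u, b>)] over the graph of [B].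
    Maximality gives [h (x, w) >= <x, w>], so
    [h + 1/2 |x|^2 + 1/2 |w|^2 >= 0].  This strongly convex function has a
    minimizer [(x0, w0)], a common point of its nested sublevel sets
    ([nested_convex_inter]).  The optimality condition, read at the graph points
    where [h (u, b) = <u, b>], says that [(- w0, - x0)] is monotonically related
    to the graph, hence belongs to it; read at this very point it gives
    [w0 = - x0]. *)
Lemma minty0 B : form_maximal B -> exists x, B x (- x).
Proof.
move=> Bmax; have Bm := Bmax.1.
have hP : hilbert_form ipP by apply: hilbert_form_pair hip hip _ _.
pose P (t : R) : set (V * V) := [set q | forall u b, B u b ->
  ip q.1 b + ip u q.2 - ip u b
  + 2^-1 * (ip q.1 q.1 + ip q.2 q.2) <= t].
have P_ge0 t q : P t q -> 0 <= t.
  move=> Pq; apply/ler_addgt0Pr => e e0.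
  have [u [b [Bu]]] := maximal_monotone_inf q.1 q.2 Bmax e0.
  have := Pq u b Bu; have := form_ge0 hip (q.1 + q.2).
  rewrite !(ipE hip) (form_sym hip q.2 q.1) ; lra.
have P_conv t1 t2 q1 q2 s : 0 <= s -> s <= 1 -> P t1 q1 -> P t2 q2 ->
    P (t1 + s * (t2 - t1) - 2^-1 * s * (1 - s) * ipP (q2 - q1) (q2 - q1))
      (q1 + s *: (q2 - q1)).
  move=> s0 s1 Pq1 Pq2 u b Bu; have h1 := Pq1 u b Bu; have h2 := Pq2 u b Bu.
  have s1' : 0 <= 1 - s by lra.
  have := lerD (ler_wpM2l s1' h1) (ler_wpM2l s0 h2).
  rewrite /form_pair /= !(ipE hip) (form_sym hip q2.1 q1.1) (form_sym hip q2.2 q1.2).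
  rewrite -subr_ge0 => h; rewrite -subr_ge0; apply: le_trans h _.
  by rewrite le_eqVlt; apply/orP; left; apply/eqP; field.
have P_closed t : form_closed (ip := ipP) (P t).
  move=> s l Ps sl u b Bu; apply/ler_addgt0Pr => e e0.
  have h1 := form_cvg_ip hP (l + (b, u)) sl.
  have [N HN] := cvg0_eventually_le e0 (cvg0N h1).
  have := HN N (leqnn _); have := Ps N u b Bu.
  have := form_ge0 hP (s N - l); rewrite /form_pair /= !(ipE hip) !mul1r.
  rewrite (form_sym hip (s N).1 l.1) (form_sym hip (s N).2 l.2).
  rewrite (form_sym hip b) (form_sym hip b l.1) (form_sym hip u) (form_sym hip u).
  lra.
have [u0 [b0 Bu0]] := maximal_monotone_nonempty Bmax.
have Pgr u b : B u b ->
    P (ip u b + 2^-1 * (ip u u + ip b b)) (u, b).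
  move=> Bu u' b' Bu' /=; have := Bm _ _ _ _ Bu Bu'; rewrite !(ipE hip).
  lra.
have Tinf : has_inf [set t | P t !=set0].
  split; first by eexists; exists (u0, b0); exact: Pgr.
  by exists 0 => t [q /P_ge0].
set mu := inf [set t | P t !=set0].
have mu_le t q : P t q -> mu <= t.
  by move=> Pq; apply: ge_inf; [exact: Tinf.2 | exists q].
have mu0 : 0 <= mu.
  apply: lb_le_inf; first exact: Tinf.1.
  by move=> t [q /P_ge0].
pose K m := P (mu + m.+1%:R^-1).
have Kex m : exists q, K m q.
  have m0 : 0 < m.+1%:R^-1 :> R by rewrite invr_gt0.
  have [t [q Pq] /ltW tm] := inf_adherent m0 Tinf.
  by exists q => u b Bu; apply: le_trans (Pq u b Bu) tm.
have [p Kp] := choice Kex.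
(* Completing the square in the inequality at [(u0, b0)] bounds the sublevel
   sets around this point. *)
pose a : V * V := (- b0, - u0).
pose D : R := 2 * (mu + 1 + ip u0 b0) + ip b0 b0 + ip u0 u0.
have pD m : ipP (p m - a) (p m - a) <= D.
  have m1 : m.+1%:R^-1 <= 1 :> R by rewrite invf_le1 // ler1n.
  have := Kp m u0 b0 Bu0; rewrite /D /form_pair /= !(ipE hip).
  rewrite (form_sym hip b0 (p m).1) (form_sym hip u0 (p m).2).
  move: m.+1%:R^-1 m1 => c; lra.
have [|||||[x0 w0] Kq0 _] := nested_convex_inter hP (K := K) (a := a) (D := D) (p := p) => //.
- move=> m k mk q Kq u b Bu; apply: le_trans (Kq u b Bu) _.
  by rewrite lerD2l lef_pV2 ?posrE // ler_nat.
- move=> m q1 q2 Kq1 Kq2.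
  have h0 : 0 <= 2^-1 :> R by rewrite invr_ge0.
  have h1 : 2^-1 <= 1 :> R by rewrite invf_le1 // ler1n.
  rewrite mid_segment.
  move=> u b Bu; apply: le_trans (P_conv _ _ _ _ _ h0 h1 Kq1 Kq2 u b Bu) _.
  have := form_ge0 hP (q2 - q1); rewrite subrr mulr0 addr0 lerBlDr lerDl => h.
  by rewrite !mulr_ge0 //; lra.
- by move=> m; exact: P_closed.
have Pq0 : P mu (x0, w0).
  move=> u b Bu; apply/ler_addgt0Pr => e e0.
  have [N HN] := cvg0_eventually_le e0 (@cvg_harmonic R).
  by apply: le_trans (Kq0 N u b Bu) _; rewrite lerD2l; exact: HN.
have key u b : B u b -> 0 <= ip u b + ip u x0 + ip b w0
    - 2^-1 * (ip x0 x0 + ip w0 w0).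
  move=> Bu; have := Pgr u b Bu; set t := (X in P X _) => Pt.
  pose d := ipP ((u, b) - (x0, w0)) ((u, b) - (x0, w0)).
  suff : 0 <= t - mu - 2^-1 * d.
    rewrite /d /t /form_pair /= !(ipE hip).
    rewrite (form_sym hip x0 u) (form_sym hip w0 b); lra.
  apply: (@ge0_of_quadratic _ _ (2^-1 * d)) => s s0 s1.
  have := mu_le _ _ (P_conv _ _ _ _ s (ltW s0) s1 Pq0 Pt); rewrite -/d.
  by rewrite -subr_ge0; congr (_ <= _); ring.
have Bq0 : B (- w0) (- x0).
  apply: Bmax.2 => u b /key.
  have := form_ge0 hip (x0 + w0); rewrite !(ipE hip).
  rewrite (form_sym hip w0 x0) (form_sym hip w0 b).
  lra.
exists (- w0).
have := key _ _ Bq0; rewrite !(ipE hip).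
have := form_ge0 hip (x0 + w0); rewrite !(ipE hip) (form_sym hip w0 x0).
move=> h1 h2.
suff /eqP : x0 + w0 = 0 by rewrite addr_eq0 => /eqP e; rewrite -e in Bq0 *.
apply: ip0; rewrite !(ipE hip) (form_sym hip w0 x0); lra.
Qed.

(** The operator [x |-> lambda B x - u] is again maximal monotone. *)
Lemma minty B (lambda : R) u : form_maximal B -> 0 < lambda ->
  exists x, exists2 b, B x b & lambda *: b + x = u.
Proof.
move=> [Bm Bmax] l0; have ln0 : lambda != 0 by rewrite gt_eqF.
pose B' x : set V := [set lambda *: b - u | b in B x].
have [|x [b Bb bx]] := minty0 (B := B').
  split=> [x y _ _ [b Bb <-] [c Bc <-]|x w H].
    have -> : lambda *: b - u - (lambda *: c - u) = lambda *: (b - c).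
      by rewrite opprB addrA subrK scalerBr.
    by rewrite (ipZr hip) pmulr_rge0 //; exact: Bm.
  exists (lambda^-1 *: (w + u)); last by rewrite scalerA divff // scale1r addrK.
  apply: Bmax => v b Bb; have := H v _ (ex_intro2 _ _ _ Bb erefl).
  have -> : w - (lambda *: b - u) = lambda *: (lambda^-1 *: (w + u) - b).
    by rewrite scalerBr scalerA divff // scale1r opprB addrA.
  by rewrite (ipZr hip) pmulr_rge0.
exists x, b => //.
by move/eqP: bx; rewrite subr_eq => /eqP ->; rewrite addrAC addNr add0r.
Qed.

End FormMonotone.

Section HilbertMonotone.
Context {R : realType} {V : hilbertType R}.
Implicit Types (B : V -> set V) (C D : set V) (F : V -> V).
Local Notation hV := (@hilbert_form_inner R V).

Lemma maximal_monotoneP B : maximal_monotone_op B ->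
  form_maximal (ip := @inner R V) B.
Proof.
move=> [Bm Bmax]; split=> // x w H.
pose B' u : set V := [set b | B u b \/ (u = x /\ b = w)].
apply: (Bmax B' _ _ x w); last by right.
  move=> u1 u2 b1 b2 [Bu1|[-> ->]] [Bu2|[-> ->]].
  - exact: Bm.
  - by have := H _ _ Bu1; rewrite !(ipE hV); lra.
  - exact: H.
  - by rewrite !subrr (ip0l hV).
by move=> u b Bu; left.
Qed.

Lemma inner_eq0 (u : V) : inner u u <= 0 -> u = 0.
Proof.
by rewrite inner_normE => h; apply/eqP; rewrite -normr_eq0 -sqrf_eq0 eq_le h sqr_ge0.
Qed.

Lemma resolvent_nonexpansive B lambda (r1 r2 x1 x2 : V) : 0 < lambda ->
  monotone_op B -> resolvent lambda B r1 x1 -> resolvent lambda B r2 x2 ->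
  `|x1 - x2| <= `|r1 - r2|.
Proof.
move=> l0 Bm [b1 B1 <-] [b2 B2 <-].
rewrite -ler_sqr ?nnegrE // -!inner_normE.
have -> : lambda *: b1 + x1 - (lambda *: b2 + x2)
    = lambda *: (b1 - b2) + (x1 - x2).
  by rewrite scalerBr opprD addrACA.
move: (Bm _ _ _ _ B1 B2); move: (b1 - b2) (x1 - x2) => b x bx.
have := form_ge0 hV (lambda *: b).
rewrite (ipDl hV) !(ipDr hV) (form_sym hV (lambda *: b) x) (ipZr hV _ b x).
have := mulr_ge0 (ltW l0) bx; lra.
Qed.

Lemma sum_monotone D F B : monotone_op (single_valued D F) -> monotone_op B ->
  monotone_op (op_add (single_valued D F) B).
Proof.
move=> Fm Bm x y _ _ [u Fu [b Bb <-]] [v Fv [c Bc <-]].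
by rewrite opprD addrACA (ipDr hV) addr_ge0 //; [exact: Fm | exact: Bm].
Qed.

(** If [(x, w)] is monotonically related to the graph of [F + B], take [u] with
    [u + l (F u + b) = x + l w] and [b] in [B u].  Then [w - (F u + b)] is a
    positive multiple of [u - x], and the monotone relation forces [u = x].
    Such a [u] is a fixed point of the map
    [u |-> (I + l B)^-1 (x + l w - l F u)] of [C] into itself, which is a
    contraction as soon as [l L < 1]. *)
Lemma sum_maximal D C F B (L : R) : 0 < L ->
  monotone_op (single_valued D F) -> L.-lipschitz_D F ->
  closed C -> C !=set0 -> C `<=` D -> op_dom B `<=` C ->
  maximal_monotone_op B ->
  form_maximal (ip := @inner R V) (op_add (single_valued D F) B).
Proof.
move=> L0 Fm Flip Ccl C0 CD BC /maximal_monotoneP Bmax.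
split=> [|x w H]; first exact: sum_monotone Bmax.1.
(* This makes the contraction factor [l * L] equal to [2^-1]. *)
pose l := (2 * L)^-1; have l0 : 0 < l by rewrite invr_gt0 mulr_gt0.
have Jex r : exists y, resolvent l B r y.
  by have := minty hV inner_eq0 r Bmax l0; exact.
have [J HJ] := choice Jex.
have JC r : C (J r) by apply: BC; have [b Bb _] := HJ r; exists b.
pose f u := J (x + l *: w - l *: F u).
have fC : {homo f : u / C u >-> C u} by move=> u _; exact: JC.
have [//|u Cu uf] := @banach_fixed_point R V C (mkfun fC) _ Ccl C0.
  exists (2^-1)%:nng; split=> /=; first by rewrite invf_lt1 // ltr1n.
  move=> [u v] [/= Cu Cv].
  apply: le_trans (resolvent_nonexpansive l0 Bmax.1 (HJ _) (HJ _)) _.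
  rewrite opprB addrC addrA subrK -scalerBr normrZ gtr0_norm //.
  rewrite distrC; have := Flip (u, v) (conj (CD _ Cu) (CD _ Cv)) => /= h.
  apply: le_trans (ler_wpM2l (ltW l0) h) _.
  by rewrite mulrA /l invfM mulfVK // gt_eqF.
have fu : J (x + l *: w - l *: F u) = u by exact: esym uf.
have [b Bb hb] := HJ (x + l *: w - l *: F u); move: Bb hb; rewrite fu.
move=> Bb hb.
have e1 : w - (F u + b) = l^-1 *: (u - x).
  apply: (scalerI (a := l)); first by rewrite gt_eqF.
  rewrite scalerA divff ?gt_eqF // scale1r scalerBr scalerDr.
  apply/eqP; rewrite eq_sym subr_eq addrC; apply/eqP.
  by rewrite opprD !addrA -hb addrAC subrr add0r.
have Tub : op_add (single_valued D F) B u (F u + b).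
  by exists (F u); [split=> //; exact: CD | exists b].
have := H _ _ Tub; rewrite e1 -(opprB x u) scalerN (ipNr hV) (ipZr hV).
have li0 : 0 < l^-1 by rewrite /l invrK mulr_gt0.
rewrite oppr_ge0 (pmulr_rle0 _ li0) => /inner_eq0 /eqP.
rewrite subr_eq0 => /eqP xu; move: e1; rewrite xu subrr scaler0 => /eqP.
by rewrite subr_eq0 => /eqP ->.
Qed.

End HilbertMonotone.

(** * Adjoints and separating functionals *)

Section BoundedOperators.
Context {R : realType} {V W : hilbertType R}.
Variables (f : {linear V -> W}) (g : W -> V).
Hypotheses (fb : bounded_operator f) (fg : is_adjoint f g).
Local Notation hV := (@hilbert_form_inner R V).
Local Notation hW := (@hilbert_form_inner R W).

Lemma opnorm_has_sup : has_sup [set `|f x| | x in [set x : V | `|x| <= 1]].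
Proof.
have [M HM] := fb; split; first by exists `|f 0|, 0 => //=; rewrite normr0.
exists `|M| => _ [x /= x1 <-]; apply: le_trans (HM x) _.
apply: le_trans (_ : `|M| * `|x| <= _); first by rewrite ler_wpM2r // ler_norm.
by rewrite -{2}[`|M|]mulr1 ler_wpM2l.
Qed.

Lemma opnorm_ge0 : 0 <= opnorm f.
Proof.
apply: le_trans (_ : `|f 0| <= _); first by [].
apply: ub_le_sup; first exact: opnorm_has_sup.2.
by exists 0 => //=; rewrite normr0.
Qed.

Lemma norm_le_opnorm x : `|f x| <= opnorm f * `|x|.
Proof.
have [->|x0] := eqVneq x 0; first by rewrite linear0 !normr0 mulr0.
have nx : 0 < `|x| by rewrite normr_gt0.
rewrite -ler_pdivrMr //; apply: ub_le_sup; first exact: opnorm_has_sup.2.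
exists (`|x|^-1 *: x); last by rewrite linearZ normrZ normfV normr_id mulrC.
by rewrite /= normrZ normfV normr_id mulVf // gt_eqF.
Qed.

Lemma inner_le_opnorm x : inner (f x) (f x) <= opnorm f ^+ 2 * inner x x.
Proof.
rewrite !inner_normE -exprMn ler_sqr ?nnegrE ?mulr_ge0 ?opnorm_ge0 //.
exact: norm_le_opnorm.
Qed.

Lemma inner_inj (u v : V) : (forall x, inner x u = inner x v) -> u = v.
Proof.
move=> H; apply/eqP; rewrite -subr_eq0; apply/eqP/inner_eq0.
by rewrite (ipDr hV) (ipNr hV) H subrr.
Qed.

Lemma adjoint_linear : linear g.
Proof.
move=> a u v; apply: inner_inj => x.
by rewrite (ipDr hV) (ipZr hV) -!fg (ipDr hW) (ipZr hW).
Qed.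

Lemma adjointB u v : g (u - v) = g u - g v.
Proof.
by have := adjoint_linear (-1) v u; rewrite !scaleN1r => e; rewrite addrC e addrC.
Qed.

Lemma inner_adjoint_le_opnorm y :
  inner (g y) (g y) <= opnorm f ^+ 2 * inner y y.
Proof.
have h : inner (g y) (g y) ^+ 2
    <= opnorm f ^+ 2 * inner (g y) (g y) * inner y y.
  rewrite -{1}fg; apply: le_trans (cauchy_schwarz hW _ _) _.
  apply: ler_wpM2r; [exact: form_ge0 hW _ | exact: inner_le_opnorm].
have := form_ge0 hV (g y); rewrite le_eqVlt => /orP[/eqP <-|gp].
  by rewrite mulr_ge0 ?sqr_ge0 // (form_ge0 hW).
by rewrite -(ler_pM2r gp) -expr2 mulrAC.
Qed.

End BoundedOperators.

Lemma sum_option (R : realType) (V : lmodType R) (I : finType)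
    (F : option I -> V) :
  \sum_j F j = F None + \sum_i F (Some i).
Proof.
rewrite (bigD1 None) //=; congr (_ + _).
rewrite (reindex_omap Some id) //=; last by case.
by apply: eq_bigl => i; rewrite eqxx.
Qed.

Section SeparatingFunctionals.
Context {R : realType} {n : nat}.
Variables (H0 : hilbertType R) (H : 'I_n.-1 -> hilbertType R).
Variables (G : forall j, {linear H0 -> sp H0 H j}).
Variables (Gs : forall j, sp H0 H j -> H0).
Hypothesis Gs_adjoint : forall j, is_adjoint (G j) (@Gs j).
Hypothesis G_last : forall z : H0, G None z = z.
Variable gamma : R.
Hypothesis gamma_gt0 : 0 < gamma.
Local Notation hS j := (@hilbert_form_inner R (sp H0 H j)).
Local Notation h0 := (@hilbert_form_inner R H0).

Definition prodE : lmodType R := (H0 * dprod (fun i => H i : lmodType R))%type.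

Definition ipg : prodE -> prodE -> R :=
  form_pair (@inner R H0) (form_dprod (fun i => @inner R (H i))) gamma.

Lemma hilbert_form_ipg : hilbert_form ipg.
Proof.
apply: hilbert_form_pair => //; first exact: hilbert_form_inner.
by apply: hilbert_form_dprod => i; exact: hilbert_form_inner.
Qed.
Local Notation hE := hilbert_form_ipg.

Lemma adjoint_last (z : H0) : Gs (z : sp H0 H None) = z.
Proof.
by apply: inner_inj => x; rewrite -(Gs_adjoint (j := None)) G_last.
Qed.

Lemma wfullB (p q : prodE) j :
  wfull Gs (p - q : prodE) j = wfull Gs p j - wfull Gs q j.
Proof.
case: j => [i|] //=.
have e : \sum_(i < n.-1) @Gs (Some i) (p.2 i - q.2 i)
    = \sum_(i < n.-1) @Gs (Some i) (p.2 i) - \sum_(i < n.-1) @Gs (Some i) (q.2 i).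
  by rewrite -sumrB; apply: eq_bigr => i _; exact: (adjointB (@Gs_adjoint (Some i))).
rewrite [X in - X = _]e opprB opprK addrC.
by [].
Qed.

Lemma sum_adjoint_wfull (p : prodE) : \sum_j Gs (wfull Gs p j) = 0.
Proof. by rewrite sum_option /= adjoint_last addNr. Qed.

Lemma sum_inner_wfull z (p : prodE) :
  \sum_j inner (G j z) (wfull Gs p j) = 0.
Proof.
under eq_bigr => j _ do rewrite Gs_adjoint.
by rewrite -(ip_sumr h0) sum_adjoint_wfull (ip0r h0).
Qed.

(** The Riesz representative of the linear part of [phi] for the product form of
    weight [gamma]: its components are the two residuals of the stopping test,
    the first one divided by [gamma]. *)
Definition phi_grad (x y : forall j, sp H0 H j) : prodE :=
  (gamma^-1 *: (\sum_j Gs (y j) : H0),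
   (fun i => x (Some i) - G (Some i) (x None)) : dprod (fun i => H i : lmodType R)).

Lemma phi_affine (x y : forall j, sp H0 H j) (q : prodE) :
  phi G Gs x y (fun=> 0) q = ipg (phi_grad x y) q - \sum_j inner (x j) (y j).
Proof.
rewrite /phi /ipg /form_pair /form_dprod /=.
transitivity (\sum_j inner (G j q.1) (y j) + \sum_j inner (x j) (wfull Gs q j)
   - \sum_j inner (x j) (y j)).
  rewrite -[RHS]subr0 -[X in _ = _ - X](sum_inner_wfull q.1 q) -!sumrN -!big_split /=.
  apply: eq_bigr => j _; rewrite !(ipE (hS j)); lra.
congr (_ + _ - _).
  transitivity (\sum_j inner q.1 (Gs (y j))).
    by apply: eq_bigr => j _; exact: Gs_adjoint.
  by rewrite -(ip_sumr h0) (ipZl h0) mulVKf ?gt_eqF // (form_sym h0).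
rewrite sum_option /= (ipNr h0) (ip_sumr h0) -sumrN -big_split /=.
apply: eq_bigr => i _; rewrite (ipDl (hS (Some i))) (ipNl (hS (Some i))).
by rewrite Gs_adjoint addrC.
Qed.

Lemma phiB (x y : forall j, sp H0 H j) (p q : prodE) :
  phi G Gs x y (fun=> 0) p - phi G Gs x y (fun=> 0) q
  = ipg (phi_grad x y) (p - q).
Proof. by rewrite !phi_affine (ipDr hE) (ipNr hE); lra. Qed.

Section ExtendedSolutions.
Variable T : forall j, sp H0 H j -> set (sp H0 H j).
Hypothesis Tmax : forall j, form_maximal (ip := @inner R (sp H0 H j)) (@T j).
Let Se := extended_solutions G Gs T.

Lemma phi_le0_extended (u v : forall j, sp H0 H j) (q : prodE) :
  (forall j, T (u j) (v j)) -> Se q -> phi G Gs u v (fun=> 0) q <= 0.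
Proof.
move=> Tuv Sq; apply: sumr_le0 => j _; rewrite subr0.
rewrite -oppr_ge0 -(ipNr (hS j)) opprB.
exact: (Tmax j).1 (Sq j) (Tuv j).
Qed.

(** For each [j] the infimum of [<G_j z - u, w_j - v>] over the graph of [T_j]
    is at most [0], by maximality.  A single negative value at the index [j0]
    can therefore be combined with values below a small [e] at the other
    indices, and the sum stays negative, against the hypothesis. *)
Lemma extended_of_phi_le0 (q : prodE) :
  (forall u v : forall j, sp H0 H j, (forall j, T (u j) (v j)) ->
     phi G Gs u v (fun=> 0) q <= 0) -> Se q.
Proof.
move=> Hq j0; apply: (Tmax j0).2 => u b Tub.
rewrite leNgt; apply/negP; set d := inner _ _ => d0.
pose N : R := #|{: option 'I_n.-1}|%:R.
have N0 : 0 < N by rewrite ltr0n; apply/card_gt0P; exists None.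
(* The [N] summands [e] together weigh only half of [- d]. *)
pose e : R := - d / (2 * N).
have e0 : 0 < e by rewrite divr_gt0 ?mulr_gt0 // oppr_gt0.
have near j : exists uv : sp H0 H j * sp H0 H j, T uv.1 uv.2 /\
    inner (G j q.1 - uv.1) (wfull Gs q j - uv.2) <= e + (if j == j0 then d else 0).
  have [->|_] := eqVneq j j0; first by exists (u, b); split=> //; rewrite lerDr ltW.
  have [u' [b' [Tu' h]]] :=
    maximal_monotone_inf (hS j) (G j q.1) (wfull Gs q j) (Tmax j) e0.
  by exists (u', b'); rewrite addr0.
pose uv j := projT1 (cid (near j)).
have uvP j := projT2 (cid (near j)).
have := Hq (fun j => (uv j).1) (fun j => (uv j).2) (fun j => (uvP j).1).
apply/negP; rewrite -ltNge.
have h : \sum_j (e + (if j == j0 then d else 0)) = N * e + d.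
  by rewrite big_split /= sumr_const -mulr_natl -big_mkcond big_pred1_eq.
apply: (@lt_le_trans _ _ (- (N * e + d))).
  have -> : N * e = - d / 2 by rewrite /e; field; rewrite gt_eqF.
  lra.
rewrite -h -sumrN; apply: ler_sum => j _; rewrite subr0 lerNl.
rewrite -(ipNr (hS j)) opprB; exact: (uvP j).2.
Qed.

End ExtendedSolutions.

End SeparatingFunctionals.

(** * The forward-backward step *)

Section StepEstimate.
Context {R : realType} {V : hilbertType R}.
Local Notation hV := (@hilbert_form_inner R V).

Lemma convex_segment (C : set V) u v (s : R) : @convex_set R V C ->
  0 <= s -> s <= 1 -> C u -> C v -> C (u + s *: (v - u)).
Proof.
move=> Cc s0 s1 Cu Cv.
have := Cc v u (Itv01 s0 s1) (mem_set Cv) (mem_set Cu) => /set_mem.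
congr (C _); rewrite /conv /=.
apply: inner_inj => t; rewrite !(ipE hV) /unstable.onem; lra.
Qed.

(** As [x] is its own projection, this is nonexpansiveness of the projection. *)
Lemma proj_dist_le (C : set V) (a c x : V) : @convex_set R V C ->
  is_proj (fun u v => `|u - v|) C a c -> C x ->
  inner (x - c) (x - c) <= inner (a - x) (a - x).
Proof.
move=> Cc [Cc0 cmin] Cx.
have := @proj_variational _ _ _ hV C a c _ Cc0 _ x Cx.
move=> /(_ (fun u v s => @convex_segment C u v s Cc)).
have hmin y : C y -> inner (a - c) (a - c) <= inner (a - y) (a - y).
  by move=> /cmin h; rewrite !inner_normE ler_sqr ?nnegrE.
move=> /(_ hmin).
have -> : a - x = (a - c) - (x - c) by rewrite opprB addrA subrK.
move: (a - c) (x - c) => u v; rewrite !(ipE hV) (form_sym hV v u).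
by have := form_ge0 hV u; lra.
Qed.

(** With [d = a - x] and [e = F x - F c] one has
    [lambda (y - w) = d + lambda e], where [lambda |e| <= sigma |d|] because
    projecting onto [C] does not increase the distance to [x].  Expanding
    [|lambda (y - w) - d|^2 <= sigma^2 |d|^2] gives the lower bound. *)
Lemma forward_backward_estimate (D C : set V) (F : V -> V) (B : V -> set V)
    (L sigma : R) (a w c x y : V) (lambda := sigma / L) :
  0 < L -> 0 < sigma -> sigma < 1 ->
  C `<=` D -> op_dom B `<=` C -> L.-lipschitz_D F -> @convex_set R V C ->
  is_proj (fun u v => `|u - v|) C a c ->
  resolvent lambda B (a + lambda *: w - lambda *: F c) x ->
  y = lambda^-1 *: (a + lambda *: w - x) + F x - F c ->
  op_add (single_valued D F) B x y /\
  (1 - sigma ^+ 2) / 2 * (lambda * inner (y - w) (y - w)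
    + lambda^-1 * inner (a - x) (a - x)) <= inner (a - x) (y - w).
Proof.
move=> L0 s0 s1 CD BC Flip Cc cproj [b Bxb hb] yE.
have l0 : 0 < lambda by rewrite divr_gt0.
have ln0 : lambda != 0 by rewrite gt_eqF.
have Cx : C x by apply: BC; exists b.
split.
  exists (F x); first by split=> //; exact: CD.
  exists b => //; rewrite yE; apply: (scalerI ln0).
  rewrite !scalerDr !scalerA divff // scale1r scalerN.
  have -> : lambda *: b = a + lambda *: w - lambda *: F c - x.
    by rewrite -hb addrK.
  by apply: inner_inj => t; rewrite !(ipE hV); lra.
have hlip : inner (F x - F c) (F x - F c) <= L ^+ 2 * inner (a - x) (a - x).
  apply: le_trans (_ : L ^+ 2 * inner (x - c) (x - c) <= _); last first.
    by rewrite ler_wpM2l ?sqr_ge0 //; exact: proj_dist_le cproj Cx.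
  rewrite !inner_normE -exprMn ler_sqr ?nnegrE ?mulr_ge0 ?(ltW L0) //.
  exact: (Flip (x, c) (conj (CD _ Cx) (CD _ cproj.1))).
have -> : y - w = lambda^-1 *: (a - x) + (F x - F c).
  rewrite yE; apply: (scalerI ln0).
  rewrite !(scalerDr, scalerN) !scalerA divff // !scale1r.
  by apply: inner_inj => t; rewrite !(ipE hV); lra.
move: hlip; move: (a - x) (F x - F c) => d e hlip.
rewrite !(ipE hV) (form_sym hV e d).
have hl : lambda * inner e e <= sigma ^+ 2 * lambda^-1 * inner d d.
  apply: le_trans (ler_wpM2l (ltW l0) hlip) _.
  rewrite le_eqVlt; apply/orP; left; apply/eqP.
  by rewrite /lambda; field; rewrite !gt_eqF.
have hpos := form_ge0 hV (lambda^-1 *: d + e).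
move: hpos; rewrite !(ipE hV) (form_sym hV e d) => hpos.
have s2 : 0 <= sigma ^+ 2 by rewrite sqr_ge0.
have := mulr_ge0 s2 (mulr_ge0 (ltW l0) hpos).
have -> : lambda * (lambda^-1 * (lambda^-1 * inner d d) + lambda^-1 * inner d e
   + (lambda^-1 * inner d e + inner e e))
  = lambda^-1 * inner d d + 2 * inner d e + lambda * inner e e by field.
move: hl; set A := lambda^-1 * inner d d; set Bq := lambda * inner e e.
have -> : sigma ^+ 2 * lambda^-1 * inner d d = sigma ^+ 2 * A.
  by rewrite /A mulrA.
set p := inner d e => h1 h2; lra.
Qed.

End StepEstimate.

(** * Size of the separating functionals *)

(** The scalar core of a separation step: [N] is the squared norm of the gradient,
    [X] the decrease of the affine function over a displacement of squared norm
    [Q], and [S] the sum of the squared residuals at the starting point. *)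
Lemma separation_bounds (R : realType) (N X Q S k c : R) :
  0 < k -> 0 < c -> 0 <= S -> 0 <= N -> 0 <= Q ->
  N <= k * S -> c * S <= X -> X ^+ 2 <= N * Q ->
  N <= (k / c) ^+ 2 * Q /\ S <= k / c ^+ 2 * Q.
Proof.
move=> k0 c0 S0 N0 Q0 NS SX XNQ.
have cS2 : (c * S) ^+ 2 <= N * Q.
  apply: le_trans XNQ; rewrite ler_sqr ?nnegrE ?(le_trans _ SX) //.
    by rewrite mulr_ge0 // ltW.
  by rewrite mulr_ge0 // ltW.
have c2 : 0 < c ^+ 2 by rewrite exprn_gt0.
split.
  have [->|Nn] := eqVneq N 0; first by rewrite mulr_ge0 ?sqr_ge0.
  have Np : 0 < N by rewrite lt_neqAle eq_sym Nn.
  rewrite -(ler_pM2l Np) expr_div_n -(ler_pM2l c2).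
  have -> : c ^+ 2 * (N * (k ^+ 2 / c ^+ 2 * Q)) = k ^+ 2 * (N * Q).
    by field; rewrite gt_eqF.
  apply: le_trans (ler_wpM2l (sqr_ge0 k) cS2).
  have -> : k ^+ 2 * (c * S) ^+ 2 = c ^+ 2 * (k * S) ^+ 2 by ring.
  rewrite ler_pM2l // -expr2 ler_sqr ?nnegrE //.
  by rewrite mulr_ge0 // ltW.
have [->|Sn] := eqVneq S 0.
  by rewrite mulr_ge0 // divr_ge0 // ltW.
have Sp : 0 < S by rewrite lt_neqAle eq_sym Sn.
rewrite -(ler_pM2l Sp) -(ler_pM2l c2).
have -> : c ^+ 2 * (S * (k / c ^+ 2 * Q)) = k * S * Q.
  by field; rewrite gt_eqF.
rewrite -expr2 -exprMn; apply: le_trans cS2 _.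
by rewrite ler_wpM2r.
Qed.

Section GradientBounds.
Context {R : realType} {n : nat}.
Variables (H0 : hilbertType R) (H : 'I_n.-1 -> hilbertType R).
Variables (G : forall j, {linear H0 -> sp H0 H j}).
Variables (Gs : forall j, sp H0 H j -> H0).
Hypothesis n_gt0 : (0 < n)%N.
Hypothesis G_bounded : forall j, bounded_operator (G j).
Hypothesis Gs_adjoint : forall j, is_adjoint (G j) (@Gs j).
Hypothesis G_last : forall z : H0, G None z = z.
Variables (gamma g : R).
Hypothesis gamma_gt0 : 0 < gamma.
Hypothesis g_ge1 : 1 <= g.
Hypothesis G_le : forall j, opnorm (G j) ^+ 2 <= g.
Local Notation hS j := (@hilbert_form_inner R (sp H0 H j)).
Local Notation h0 := (@hilbert_form_inner R H0).
Local Notation prodE := (prodE H0 H).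

(** The amount by which the pairs [(x j, y j)] fail to be
    [(G_j z, w_j)] at the point [q = (z, w)]. *)
Definition residual (q : prodE) (x y : forall j, sp H0 H j) : R :=
  \sum_j (inner (y j - wfull Gs q j) (y j - wfull Gs q j)
          + inner (G j q.1 - x j) (G j q.1 - x j)).

Lemma card_indices : #|{: option 'I_n.-1}| = n.
Proof. by rewrite card_option card_ord prednK. Qed.

(** Since [sum_j Gs_j w_j = 0] and [x_i - G_i x_n] vanishes when [x_j = G_j z]
    for all [j], both components of the gradient can be written with the
    residuals at [q]; the rest is Cauchy-Schwarz for finite sums. *)
Lemma phi_grad_le (q : prodE) (x y : forall j, sp H0 H j) :
  ipg gamma (phi_grad G Gs gamma x y) (phi_grad G Gs gamma x y)
  <= 2 * n%:R * g * Num.max 1 (1 / gamma) * residual q x y.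
Proof.
have g0 : 0 <= g by apply: le_trans g_ge1.
set m := Num.max 1 (1 / gamma).
have m1 : 1 <= m by rewrite le_max lexx.
have mg : gamma^-1 <= m by rewrite le_max div1r lexx orbT.
have n1 : 1 <= n%:R :> R by rewrite ler1n.
rewrite /residual big_split /=.
set Sb := \sum_j inner (y j - _) _; set Sa := \sum_j inner (G j q.1 - _) _.
have Sb0 : 0 <= Sb by apply: sumr_ge0 => j _; exact: form_ge0 (hS j) _.
have Sa0 : 0 <= Sa by apply: sumr_ge0 => j _; exact: form_ge0 (hS j) _.
have hy : inner (\sum_j Gs (y j)) (\sum_j Gs (y j)) <= n%:R * (g * Sb).
  have -> : \sum_j Gs (y j) = \sum_j Gs (y j - wfull Gs q j).
    under [RHS]eq_bigr => j _ do rewrite (adjointB (@Gs_adjoint j)).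
    by rewrite sumrB (sum_adjoint_wfull Gs_adjoint G_last) subr0.
  apply: le_trans (sum_sq_le h0 _) _; rewrite card_indices ler_wpM2l //.
  rewrite /Sb mulr_sumr; apply: ler_sum => j _.
  apply: le_trans (inner_adjoint_le_opnorm (@G_bounded j) (@Gs_adjoint j) _) _.
  by rewrite ler_wpM2r // (form_ge0 (hS j)).
have hx : \sum_(i < n.-1) inner (x (Some i) - G (Some i) (x None))
    (x (Some i) - G (Some i) (x None)) <= 2 * n%:R * g * Sa.
  have hi i : inner (x (Some i) - G (Some i) (x None))
      (x (Some i) - G (Some i) (x None))
    <= 2 * inner (G (Some i) q.1 - x (Some i)) (G (Some i) q.1 - x (Some i))
       + 2 * (g * inner (G None q.1 - x None) (G None q.1 - x None)).
    have -> : x (Some i) - G (Some i) (x None)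
        = - (G (Some i) q.1 - x (Some i)) + G (Some i) (G None q.1 - x None).
      by rewrite G_last (linearB (G (Some i))) /= opprB addrA subrK.
    apply: le_trans (ip_sqD_le (hS (Some i)) _ _) _.
    rewrite (ipNl (hS (Some i))) (ipNr (hS (Some i))) opprK lerD2l ler_pM2l //.
    apply: le_trans (inner_le_opnorm (@G_bounded (Some i)) _) _.
    by rewrite ler_wpM2r // (form_ge0 h0).
  apply: le_trans (ler_sum _ (fun i _ => hi i)) _.
  rewrite big_split /= -mulr_sumr sumr_const card_ord -[(_ * _) *+ _]mulr_natl.
  rewrite /Sa sum_option /=.
  set A := inner (G None q.1 - x None) _.
  set Bs := \sum_(i < n.-1) _.
  have A0 : 0 <= A by exact: form_ge0 h0 _.
  have B0 : 0 <= Bs by apply: sumr_ge0 => i _; exact: form_ge0 (hS (Some i)) _.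
  have hn : n.-1%:R <= n%:R :> R by rewrite ler_nat leq_pred.
  have ng : 1 <= n%:R * g by apply: le_trans n1 _; rewrite ler_peMr.
  have gA : 0 <= g * A by rewrite mulr_ge0.
  have := ler_wpM2r gA hn; have := ler_wpM2r B0 ng.
  rewrite mul1r mulrDr; move: n.-1%:R => N' *; lra.
have ngb : 0 <= n%:R * (g * Sb) by rewrite !mulr_ge0.
have nga : 0 <= n%:R * (g * Sa) by rewrite !mulr_ge0.
have hY : gamma * inner (gamma^-1 *: \sum_j Gs (y j)) (gamma^-1 *: \sum_j Gs (y j))
    <= m * (n%:R * (g * Sb)).
  rewrite (ipZl h0) (ipZr h0) mulVKf ?gt_eqF //.
  apply: le_trans (ler_wpM2l _ hy) _; first by rewrite invr_ge0 ltW.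
  by rewrite ler_wpM2r.
apply: le_trans (lerD hY hx) _.
have := ler_wpM2r nga m1; have : 0 <= m * (n%:R * (g * Sb)).
  by rewrite mulr_ge0 // (le_trans _ m1).
rewrite mulrDr; move: n%:R => N' *; lra.
Qed.

Lemma phi_ge_residual (q : prodE) (x y : forall j, sp H0 H j)
    (lambda : option 'I_n.-1 -> R) (sigma M : R) :
  sigma ^+ 2 <= 1 ->
  (forall j, M^-1 <= lambda j) -> (forall j, M^-1 <= (lambda j)^-1) ->
  (forall j, (1 - sigma ^+ 2) / 2 *
     (lambda j * inner (y j - wfull Gs q j) (y j - wfull Gs q j)
      + (lambda j)^-1 * inner (G j q.1 - x j) (G j q.1 - x j))
     <= inner (G j q.1 - x j) (y j - wfull Gs q j)) ->
  (1 - sigma ^+ 2) / (2 * M) * residual q x y <= phi G Gs x y (fun=> 0) q.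
Proof.
move=> s1 Ml Mli H1; rewrite /residual mulr_sumr; apply: ler_sum => j _.
rewrite subr0; apply: le_trans (H1 j); rewrite invfM mulrA -mulrA ler_wpM2l //.
  by rewrite divr_ge0 // subr_ge0.
by rewrite mulrDr lerD // ler_wpM2r // (form_ge0 (hS j)).
Qed.

End GradientBounds.

(** * Haugazeau iterations with extrapolated points *)

Section Haugazeau.
Context {R : realType} {E : lmodType R} {ip : E -> E -> R}.
Hypothesis hip : hilbert_form ip.
Variables (p : nat -> E) (K : nat -> set E) (S : set E).
Let W k : set E := [set q | ip (p 0%N - p k) (q - p k) <= 0].
Hypothesis K_convex : forall k u v s, 0 <= s -> s <= 1 ->
  K k u -> K k v -> K k (u + s *: (v - u)).
Hypothesis S_sub_K : forall k, S `<=` K k.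
Hypothesis p_mem : forall k, (K k `&` W k) (p k.+1).
Hypothesis p_min : forall k y, (K k `&` W k) y ->
  ip (p 0%N - p k.+1) (p 0%N - p k.+1) <= ip (p 0%N - y) (p 0%N - y).
Let C k := ip (p k - p 0%N) (p k - p 0%N).
Let A k := ip (p k.+1 - p k) (p k.+1 - p k).

(** By induction: once [S] lies in [W k], it lies in the convex set
    [K k `&` W k], and the variational inequality of the projection [p k.+1]
    is the statement for [k.+1]. *)
Lemma haugazeau_sub k : S `<=` W k.
Proof.
elim: k => [|k IHk] q Sq; first by rewrite /W /= subrr (ip0l hip).
apply: (proj_variational hip (S := K k `&` W k)) => //.
- move=> u v s s0 s1 [Ku Wu] [Kv Wv]; split; first exact: K_convex.
  move: Wu Wv; rewrite /W /=; move: (p 0%N - p k) => w Wu Wv.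
  have -> : ip w (u + s *: (v - u) - p k)
      = - ((1 - s) * (- ip w (u - p k)) + s * (- ip w (v - p k))).
    by rewrite !(ipE hip); ring.
  rewrite oppr_le0 addr_ge0 ?mulr_ge0 //.
  + by rewrite subr_ge0.
  + by rewrite oppr_ge0.
  + by rewrite oppr_ge0.
- by move=> y; exact: p_min.
- by split; [exact: S_sub_K | exact: IHk].
Qed.

Lemma haugazeau_dist_le q k : S q ->
  C k <= ip (q - p 0%N) (q - p 0%N).
Proof.
move=> Sq; rewrite /C; case: k => [|k].
  by rewrite subrr (ip0l hip) (form_ge0 hip).
rewrite [leLHS](sq_oppB hip) [leRHS](sq_oppB hip).
by apply: p_min; split; [exact: S_sub_K | exact: haugazeau_sub].
Qed.

(** Membership of [p k.+1] in [W k] says that the angle at [p k] is obtuse. *)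
Lemma haugazeau_step k : A k <= C k.+1 - C k.
Proof.
have := (p_mem k).2; rewrite /A /C /W /= !(ipE hip).
rewrite (form_sym hip (p k.+1) (p 0%N)) (form_sym hip (p k) (p 0%N)).
rewrite (form_sym hip (p k) (p k.+1)); lra.
Qed.

Lemma haugazeau_sum k : \sum_(0 <= l < k) A l <= C k.
Proof.
elim: k => [|k IHk]; first by rewrite big_geq // /C (form_ge0 hip).
by rewrite big_nat_recr //=; have := haugazeau_step k; move: IHk; lra.
Qed.

Definition extrapolation (a b : R) (u u_prev u0 : E) : E :=
  let hat := u + a *: (u - u_prev) in hat + b *: (hat - u0).

(** The displacement is [u + a v] with
    [u = b (p k - p 0) - (p k.+1 - p k)] and [v = (1 + b) (p k - p k.-1)].
    Convexity of the square bounds it by [(1 + a) (|u|^2 + a |v|^2)], and the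
    cross term of [|u|^2] has the favourable sign because [p k.+1] lies in
    [W k]. *)
Lemma extrapolation_dist (a b : R) k
    (d := extrapolation a b (p k) (p k.-1) (p 0%N) - p k.+1) :
  0 <= a -> 0 <= b -> ip d d <= (1 + a) * (A k + b ^+ 2 * C k
     + a * (1 + b) ^+ 2 * ip (p k - p k.-1) (p k - p k.-1)).
Proof.
move=> a0 b0.
have uv u v : ip (u + a *: v) (u + a *: v) <= (1 + a) * (ip u u + a * ip v v).
  have := mulr_ge0 a0 (form_ge0 hip (u - v)); rewrite !(ipE hip).
  rewrite (form_sym hip v u); lra.
pose u := b *: (p k - p 0%N) - (p k.+1 - p k).
pose v := (1 + b) *: (p k - p k.-1).
have u2 : ip u u <= A k + b ^+ 2 * C k.
  have := mulr_ge0 b0 (_ : 0 <= - ip (p 0%N - p k) (p k.+1 - p k)).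
  rewrite oppr_ge0 => /(_ (p_mem k).2); rewrite /u /A /C.
  rewrite -(opprB (p k) (p 0%N)).
  move: (p k - p 0%N) (p k.+1 - p k) => c e; rewrite !(ipE hip).
  rewrite (form_sym hip e c); lra.
have -> : ip d d = ip (u + a *: v) (u + a *: v).
  rewrite /d /u /v /extrapolation.
  move: (p k) (p k.+1) (p k.-1) (p 0%N) => x x' y x0.
  rewrite !(ipE hip) (form_sym hip x' x) (form_sym hip y x) (form_sym hip x0 x).
  rewrite (form_sym hip x' y) (form_sym hip x0 y) (form_sym hip x0 x'); ring.
apply: le_trans (uv u v) _; rewrite ler_wpM2l ?addr_ge0 //.
rewrite lerD // /v (ipZl hip) (ipZr hip) le_eqVlt; apply/orP; left; apply/eqP.
by ring.
Qed.

(** Summing [extrapolation_dist], the squared steps contribute at most [D] and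
    the distances [C l] are at most [D].  The resulting factor
    [(1 + a) (1 + a (1 + b)^2 + s)] is below the stated one, which has an
    additional [(1 + a) b]. *)
Lemma extrapolation_sum (alpha beta : nat -> R) (a b s D : R) k :
  0 <= a -> 0 <= b -> 0 <= s ->
  (forall l, 0 <= alpha l <= a) -> (forall l, 0 <= beta l <= b) ->
  \sum_(0 <= l < k) beta l ^+ 2 <= s -> (forall l, C l <= D) ->
  \sum_(0 <= l < k)
    ip (extrapolation (alpha l) (beta l) (p l) (p l.-1) (p 0%N) - p l.+1)
       (extrapolation (alpha l) (beta l) (p l) (p l.-1) (p 0%N) - p l.+1)
  <= (1 + a) * ((1 + b) * (1 + a * (1 + b)) + s) * D.
Proof.
move=> a0 b0 s0 ha hb hs CD.
have A0 l : 0 <= A l by exact: form_ge0 hip _.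
have C0 l : 0 <= C l by exact: form_ge0 hip _.
have D0 : 0 <= D by exact: le_trans (C0 0%N) (CD 0%N).
pose B l := ip (p l - p l.-1) (p l - p l.-1).
have B0 l : 0 <= B l by exact: form_ge0 hip _.
have sumA : \sum_(0 <= l < k) A l <= D by exact: le_trans (haugazeau_sum k) (CD k).
have sumB : \sum_(0 <= l < k) B l <= D.
  case: (k) => [|k']; first by rewrite big_geq.
  rewrite big_nat_recl //= {1}/B /= subrr (ip0l hip) add0r.
  exact: le_trans (haugazeau_sum k') (CD k').
have term l : ip (extrapolation (alpha l) (beta l) (p l) (p l.-1) (p 0%N) - p l.+1)
       (extrapolation (alpha l) (beta l) (p l) (p l.-1) (p 0%N) - p l.+1)
    <= (1 + a) * (A l + beta l ^+ 2 * D + a * (1 + b) ^+ 2 * B l).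
  have /andP[al0 ala] := ha l; have /andP[bl0 blb] := hb l.
  apply: le_trans (extrapolation_dist l al0 bl0) _; apply: ler_pM.
  - by rewrite addr_ge0.
  - by rewrite !addr_ge0 ?mulr_ge0 ?sqr_ge0 ?addr_ge0 // (form_ge0 hip).
  - by rewrite lerD2l.
  apply: lerD; first by rewrite lerD2l ler_wpM2l ?sqr_ge0.
  rewrite ler_wpM2r // ?(B0 l) // ler_pM ?sqr_ge0 //.
  by rewrite ler_sqr ?nnegrE ?addr_ge0 // lerD2l.
apply: le_trans (ler_sum_nat (fun l _ => term l)) _.
rewrite -mulr_sumr -mulrA ler_wpM2l ?addr_ge0 //.
rewrite !big_split /= -mulr_suml -mulr_sumr.
have ab0 : 0 <= a * (1 + b) ^+ 2 by rewrite mulr_ge0 ?sqr_ge0.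
have h1 := ler_wpM2r D0 hs; have h2 := ler_wpM2l ab0 sumB.
have bD := mulr_ge0 b0 D0.
lra.
Qed.

Lemma haugazeau_step_cvg0 (D : R) : (forall l, C l <= D) ->
  A k @[k --> \oo] --> 0.
Proof.
move=> CD; apply: (@bounded_sum_cvg0 _ _ D) => k; first exact: form_ge0 hip _.
exact: le_trans (haugazeau_sum k) (CD k).
Qed.

End Haugazeau.

(** * The algorithm *)

Section Algorithm.
Context {R : realType} {n : nat}.
Variables (H0 : hilbertType R) (H : 'I_n.-1 -> hilbertType R).
Variables (domF : forall j, set (sp H0 H j)) (F : forall j, sp H0 H j -> sp H0 H j).
Variables (B : forall j, sp H0 H j -> set (sp H0 H j)).
Variables (C : forall j, set (sp H0 H j)).
Variables (G : forall j, {linear H0 -> sp H0 H j}).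
Variables (Gs : forall j, sp H0 H j -> H0).
Variables (L : option 'I_n.-1 -> R) (sigma gamma : R) (alpha beta : nat -> R).
Variables (p : nat -> prodsp H0 H) (zbar x y : nat -> forall j, sp H0 H j).
Hypothesis n_gt0 : (0 < n)%N.
Hypothesis H0_nontrivial : exists z : H0, z != 0.
Hypothesis F_monotone : forall j, monotone_op (single_valued (@domF j) (@F j)).
Hypothesis B_maximal : forall j, maximal_monotone_op (@B j).
Hypothesis C_nonempty : forall j, @C j !=set0.
Hypothesis C_closed : forall j, closed (@C j).
Hypothesis C_convex : forall j, @convex_set R (sp H0 H j) (@C j).
Hypothesis domB_sub_C : forall j, op_dom (@B j) `<=` @C j.
Hypothesis C_sub_domF : forall j, @C j `<=` @domF j.
Hypothesis G_bounded : forall j, bounded_operator (G j).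
Hypothesis Gs_adjoint : forall j, is_adjoint (G j) (@Gs j).
Hypothesis G_last : forall z : H0, G None z = z.
Let T := fun j => op_add (single_valued (@domF j) (@F j)) (@B j).
Hypothesis has_solution : solutions G Gs T !=set0.
Hypothesis L_gt0 : forall j, 0 < L j.
Hypothesis F_lipschitz : forall j, (L j).-lipschitz_(@domF j) (@F j).
Hypothesis sigma_gt0 : 0 < sigma.
Hypothesis sigma_lt1 : sigma < 1.
Hypothesis gamma_gt0 : 0 < gamma.
Hypothesis algorithm : generated_sequences G Gs F B C (fun j => sigma / L j)
  gamma alpha beta p zbar x y.
Hypothesis alpha_bounded : has_ubound (range alpha).
Hypothesis beta_summable : cvgn (series (fun k => beta k ^+ 2)).

Local Notation hS j := (@hilbert_form_inner R (sp H0 H j)).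
Local Notation h0 := (@hilbert_form_inner R H0).
Local Notation prodE := (prodE H0 H).
Local Notation ip := (@ipg R n H0 H gamma).
Let hE : hilbert_form ip := hilbert_form_ipg H0 H gamma_gt0.
Local Notation phik u v := (phi G Gs u v (fun=> 0)).
Local Notation sqn u := (ip (u : prodE) (u : prodE)).
Let Se := extended_solutions G Gs T.
Let pE (k : nat) : prodE := p k.
Let pt (k : nat) : prodE := ptilde alpha beta p k.

Let Lmax := \big[Num.max/L None]_j L j.
Let Lmin := \big[Num.min/L None]_j L j.
Let maxG2 := \big[Num.max/opnorm (G None) ^+ 2]_j opnorm (G j) ^+ 2.
(** A common bound for the step sizes [sigma / L j] and their inverses. *)
Let M := Num.max (Lmax / sigma) (sigma / Lmin).
Let d0 := inf [set dist_gamma gamma (p 0%N) q | q in Se].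

Lemma T_maximal j : form_maximal (ip := @inner R (sp H0 H j)) (@T j).
Proof.
exact: sum_maximal (L_gt0 j) (@F_monotone j) (@F_lipschitz j) (@C_closed j)
  (C_nonempty j) (@C_sub_domF j) (@domB_sub_C j) (@B_maximal j).
Qed.

Lemma iterate_estimate k j : T (x k j) (y k j) /\
  (1 - sigma ^+ 2) / 2 *
     (sigma / L j * inner (y k j - wfull Gs (pt k) j) (y k j - wfull Gs (pt k) j)
      + (sigma / L j)^-1 * inner (G j (pt k).1 - x k j) (G j (pt k).1 - x k j))
     <= inner (G j (pt k).1 - x k j) (y k j - wfull Gs (pt k) j).
Proof.
exact: forward_backward_estimate (L_gt0 j) sigma_gt0 sigma_lt1 (@C_sub_domF j)
  (@domB_sub_C j) (@F_lipschitz j) (@C_convex j) (zbar_def algorithm k j)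
  (x_def algorithm k j) (y_def algorithm k j).
Qed.

Lemma opnorm_le_maxG2 j : opnorm (G j) ^+ 2 <= maxG2.
Proof. exact: le_bigmax. Qed.

Lemma maxG2_ge1 : 1 <= maxG2.
Proof.
have [z z0] := H0_nontrivial; have nz : 0 < `|z| by rewrite normr_gt0.
apply: le_trans (opnorm_le_maxG2 None).
have : 1 <= opnorm (G None).
  have := norm_le_opnorm (@G_bounded None) z; rewrite G_last.
  by rewrite -[leLHS]mul1r ler_pM2r.
by move=> h; rewrite -[1](expr1n _ 2) ler_sqr ?nnegrE // (le_trans _ h).
Qed.

Lemma step_le_M j : (sigma / L j)^-1 <= M /\ sigma / L j <= M.
Proof.
split; rewrite /M le_max.
  by rewrite invf_div ler_pM2r ?invr_gt0 // le_bigmax.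
have Lmin0 : 0 < Lmin by apply: lt_bigmin => // *; exact: L_gt0.
apply/orP; right; rewrite ler_pM2l // lef_pV2 ?posrE //.
exact: (bigmin_inf j).
Qed.

Lemma M_gt0 : 0 < M.
Proof.
by have [_] := step_le_M None; apply: lt_le_trans; rewrite divr_gt0.
Qed.

Lemma Se_nonempty : exists q : prodE, Se q.
Proof.
have [z [v [Tv sv]]] := has_solution.
exists (z, fun i => v (Some i)) => -[i|]; first exact: Tv.
have -> : wfull Gs (z, fun i => v (Some i)) None = v None; last exact: Tv.
move: sv; rewrite sum_option /= (adjoint_last Gs_adjoint G_last) => /eqP.
by rewrite addr_eq0 => /eqP ->.
Qed.

Lemma Hk_convex k (u v : prodE) (s : R) : 0 <= s -> s <= 1 ->
  Hk G Gs x y k u -> Hk G Gs x y k v ->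
  Hk G Gs x y k (u + s *: (v - u) : prodE).
Proof.
move=> s0 s1; rewrite /Hk /= => hu hv.
have e1 := phiB Gs_adjoint G_last gamma_gt0 (x k) (y k) (u + s *: (v - u) : prodE) u.
have e2 := phiB Gs_adjoint G_last gamma_gt0 (x k) (y k) v u.
have eu : u + s *: (v - u) - u = s *: (v - u) by rewrite addrAC subrr add0r.
move: e1; rewrite eu (ipZr hE) -e2 => /eqP; rewrite subr_eq => /eqP ->.
have s1' : 0 <= 1 - s by rewrite subr_ge0.
have := mulr_ge0_le0 s0 hv; have := mulr_ge0_le0 s1' hu.
move: (phi _ _ _ _ _ v) (phi _ _ _ _ _ u) => a b; lra.
Qed.

Lemma Se_sub_Hk k : Se `<=` Hk G Gs x y k.
Proof.
move=> q Sq; apply: (phi_le0_extended T_maximal) => // j.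
exact: (iterate_estimate k j).1.
Qed.

Lemma p_next_mem k :
  (Hk G Gs x y k `&` [set q | ip (pE 0 - pE k) (q - pE k) <= 0]) (pE k.+1).
Proof. exact: (p_next algorithm k).1. Qed.

Lemma p_next_min k (q : prodE) :
  (Hk G Gs x y k `&` [set q | ip (pE 0 - pE k) (q - pE k) <= 0]) q ->
  sqn (pE 0 - pE k.+1) <= sqn (pE 0 - q).
Proof.
move=> Kq; have := (p_next algorithm k).2 q Kq.
by rewrite /dist_gamma /norm_gamma ler_sqrt // (form_ge0 hE).
Qed.

Lemma dist_le_Se (q : prodE) k : Se q -> sqn (pE k - pE 0) <= sqn (q - pE 0).
Proof.
move=> Sq.
exact: (haugazeau_dist_le hE Hk_convex Se_sub_Hk p_next_mem p_next_min k Sq).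
Qed.

Let cgamma := Num.max 1 (1 / gamma).
Let kappa := 2 * n%:R * maxG2 * cgamma.
(** [phi] at the extrapolated point is at least [slope] times the residual
    ([phi_ge_residual]), and the squared gradient is at most [kappa] times the
    residual ([phi_grad_le]); the quotient [kappa / slope] is the constant of
    the complexity bound. *)
Let slope := (1 - sigma ^+ 2) / (2 * M).
Let grad k : prodE := phi_grad G Gs gamma (x k) (y k).
Let res k := residual G Gs (pt k) (x k) (y k).
Let disp k := sqn (pt k - pE k.+1).

Lemma sigma2_lt1 : 0 < 1 - sigma ^+ 2.
Proof. by rewrite subr_gt0 expr_lt1 // ltW. Qed.

Lemma kappa_gt0 : 0 < kappa.
Proof.
have g0 : 0 < maxG2 by apply: lt_le_trans maxG2_ge1.
by rewrite /kappa !mulr_gt0 ?ltr0n // lt_max ltr01.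
Qed.

Lemma slope_gt0 : 0 < slope.
Proof. by rewrite /slope divr_gt0 ?sigma2_lt1 // mulr_gt0 ?M_gt0. Qed.

Lemma res_ge0 k : 0 <= res k.
Proof.
by apply: sumr_ge0 => j _; rewrite addr_ge0 // (form_ge0 (hS j)).
Qed.

(** [phi] is nonpositive at [p k.+1], so its value at [pt k] is at most the
    scalar product of the gradient with the displacement. *)
Lemma step_bounds k :
  sqn (grad k) <= (kappa / slope) ^+ 2 * disp k /\ res k <= kappa / slope ^+ 2 * disp k.
Proof.
apply: (separation_bounds (X := ip (grad k) (pt k - pE k.+1))).
- exact: kappa_gt0.
- exact: slope_gt0.
- exact: res_ge0.
- exact: form_ge0 hE _.
- exact: form_ge0 hE _.
- exact: (phi_grad_le n_gt0 G_bounded Gs_adjoint G_last gamma_gt0 maxG2_ge1 opnorm_le_maxG2).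
- have h1 : slope * res k <= phik (x k) (y k) (pt k).
    apply: (phi_ge_residual (lambda := fun j => sigma / L j)).
    + by have := sigma2_lt1; rewrite subr_gt0 => /ltW.
    + move=> j; have [h _] := step_le_M j.
      by rewrite -[leRHS]invrK lef_pV2 // posrE ?M_gt0 // invr_gt0 divr_gt0.
    + move=> j; have [_ h] := step_le_M j.
      by rewrite lef_pV2 // posrE ?M_gt0 // divr_gt0.
    + by move=> j; exact: (iterate_estimate k j).2.
  rewrite -(phiB Gs_adjoint G_last gamma_gt0); apply: le_trans h1 _.
  by rewrite lerBrDr gerDl; exact: (p_next_mem k).1.
- exact: cauchy_schwarz hE _ _.
Qed.

Lemma alpha_bounds k : 0 <= alpha k <= sup (range alpha).
Proof.
rewrite (alpha_ge0 algorithm)/=; apply: ub_le_sup => //; by exists k.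
Qed.

Let s := limn (series (fun k => beta k ^+ 2)).

Lemma beta_sum_le k : \sum_(0 <= l < k) beta l ^+ 2 <= s.
Proof. by apply: sum_le_limn => // l; exact: sqr_ge0. Qed.

Lemma s_ge0 : 0 <= s.
Proof. by apply: le_trans (beta_sum_le 0); rewrite big_geq. Qed.

Lemma beta_bounds k : 0 <= beta k <= sup (range beta).
Proof.
rewrite (beta_ge0 algorithm)/=; apply: ub_le_sup; last by exists k.
exists (Num.sqrt s) => _ [l _ <-].
rewrite -(ger0_norm (beta_ge0 algorithm l)) -sqrtr_sqr ler_wsqrtr //.
apply: le_trans (beta_sum_le l.+1); rewrite big_nat_recr //= lerDr.
by apply: sumr_ge0 => m _; exact: sqr_ge0.
Qed.

Lemma sup_alpha_ge0 : 0 <= sup (range alpha).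
Proof. by have /andP[] := alpha_bounds 0; exact: le_trans. Qed.

Lemma sup_beta_ge0 : 0 <= sup (range beta).
Proof. by have /andP[] := beta_bounds 0; exact: le_trans. Qed.

Lemma Omega_ge0 : 0 <= Omega alpha beta.
Proof.
have a0 := sup_alpha_ge0; have b0 := sup_beta_ge0; have s0 := s_ge0.
by rewrite /Omega -/s !(mulr_ge0, addr_ge0).
Qed.

Lemma disp_sum_le (D : R) k : (forall l, sqn (pE l - pE 0) <= D) ->
  \sum_(0 <= l < k) disp l <= Omega alpha beta * D.
Proof.
move=> CD.
exact: (extrapolation_sum hE p_next_mem sup_alpha_ge0 sup_beta_ge0 s_ge0
  alpha_bounds beta_bounds (beta_sum_le k) CD).
Qed.

Lemma d0_ge0 : 0 <= d0.
Proof.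
have [q Sq] := Se_nonempty; apply: lb_le_inf.
  by exists (dist_gamma gamma (p 0%N) q), q.
by move=> _ [q' _ <-]; exact: sqrtr_ge0.
Qed.

Lemma dist_le_d0 k : sqn (pE k - pE 0) <= d0 ^+ 2.
Proof.
have [q0 Sq0] := Se_nonempty.
suff h : Num.sqrt (sqn (pE k - pE 0)) <= d0.
  rewrite -[leLHS]sqr_sqrtr ?(form_ge0 hE) // ler_sqr ?nnegrE ?sqrtr_ge0 //.
  exact: d0_ge0.
apply: lb_le_inf; first by exists (dist_gamma gamma (p 0%N) q0), q0.
move=> _ [q Sq <-]; rewrite /dist_gamma /norm_gamma ler_wsqrtr //.
have := dist_le_Se k Sq; rewrite [leRHS](sq_oppB hE); exact.
Qed.

Lemma complexity k : exists2 l : nat, (l <= k)%N &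
  sqn (grad l) <= (kappa / slope) ^+ 2 * (Omega alpha beta * d0 ^+ 2 / k.+1%:R).
Proof.
have [l lk hl] := exists_le_average (disp_sum_le k.+1 dist_le_d0).
exists l => //; apply: le_trans (step_bounds l).1 _.
by rewrite ler_wpM2l // sqr_ge0.
Qed.

Lemma iteration_complexity (k : nat)
  (rate := n%:R * maxG2 * M * d0 / Num.sqrt k.+1%:R) :
  exists2 l : nat, (l <= k)%N &
     (forall j, T (x l j) (y l j)) /\
     `|\sum_(i < n.-1) Gs (y l (Some i)) + y l None : H0|
       <= rate * (4 * Num.sqrt gamma * cgamma
                    * Num.sqrt (Omega alpha beta) / (1 - sigma ^+ 2)) /\
     (forall i : 'I_n.-1,
        `|x l (Some i) - G (Some i) (x l None)|
          <= rate * (4 * cgamma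
                       * Num.sqrt (Omega alpha beta) / (1 - sigma ^+ 2))).
Proof.
have [l lk hl] := complexity k; exists l => //; split.
  by move=> j; exact: (iterate_estimate l j).1.
set bound := rate * (4 * cgamma * Num.sqrt (Omega alpha beta) / (1 - sigma ^+ 2)).
have mx0 : 0 < cgamma by rewrite lt_max ltr01.
have bound0 : 0 <= bound.
  have g0 : 0 <= maxG2 by apply: le_trans maxG2_ge1.
  rewrite /bound /rate !mulr_ge0 ?invr_ge0 ?sqrtr_ge0 ?d0_ge0 ?(ltW sigma2_lt1) //.
  - exact: ltW M_gt0.
  - exact: ltW.
have bound2 : (kappa / slope) ^+ 2 * (Omega alpha beta * d0 ^+ 2 / k.+1%:R) = bound ^+ 2.
  rewrite /bound /rate /kappa /slope.
  have k0 : 0 < Num.sqrt k.+1%:R :> R by rewrite sqrtr_gt0 ltr0n.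
  rewrite -{1}(sqr_sqrtr Omega_ge0) -{1}(sqr_sqrtr (ler0n R k.+1)).
  have sg0 : 1 - sigma ^+ 2 != 0 by rewrite gt_eqF // sigma2_lt1.
  have M0 : M != 0 by rewrite gt_eqF // M_gt0.
  field.
  by rewrite sg0 gt_eqF.
rewrite bound2 in hl.
have hx (i : 'I_n.-1) : `|x l (Some i) - G (Some i) (x l None)| <= bound.
  rewrite -ler_sqr ?nnegrE // -(@inner_normE R (H i)); apply: le_trans hl.
  rewrite /ipg /form_pair /form_dprod /= (bigD1 i) //= addrCA lerDl.
  rewrite addr_ge0 ?mulr_ge0 ?(ltW gamma_gt0) ?(form_ge0 h0) //.
  by apply: sumr_ge0 => m _; exact: form_ge0 (hS (Some m)) _.
split=> //.
have -> : rate * (4 * Num.sqrt gamma * cgamma * Num.sqrt (Omega alpha beta)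
    / (1 - sigma ^+ 2)) = Num.sqrt gamma * bound by rewrite /bound; ring.
have sb0 : 0 <= Num.sqrt gamma * bound by apply: mulr_ge0 => //; exact: sqrtr_ge0.
rewrite -ler_sqr; last 2 first.
- by rewrite nnegrE.
- by rewrite nnegrE.
rewrite exprMn -(@inner_normE R H0).
rewrite sqr_sqrtr ?(ltW gamma_gt0) //.
have -> : \sum_(i < n.-1) Gs (y l (Some i)) + y l None = \sum_j Gs (y l j).
  by rewrite sum_option /= (adjoint_last Gs_adjoint G_last) addrC.
apply: le_trans (ler_wpM2l (ltW gamma_gt0) hl).
rewrite /ipg /form_pair /form_dprod /= (ipZl h0) (ipZr h0) mulrDr.
rewrite !(mulVKf (lt0r_neq0 gamma_gt0)) lerDl mulr_ge0 //.
  exact: ltW.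
by apply: sumr_ge0 => m _; exact: form_ge0 (hS (Some m)) _.
Qed.

Lemma disp_le (k : nat) : disp k <= Omega alpha beta * d0 ^+ 2.
Proof.
apply: le_trans (disp_sum_le k.+1 dist_le_d0).
rewrite big_nat_recr //= lerDr; apply: sumr_ge0 => l _.
exact: form_ge0 hE _.
Qed.

Lemma disp_cvg0 : disp k @[k --> \oo] --> 0.
Proof.
apply: (@bounded_sum_cvg0 _ _ (Omega alpha beta * d0 ^+ 2)) => k.
  exact: form_ge0 hE _.
exact: disp_sum_le dist_le_d0.
Qed.

Lemma res_cvg0 : res k @[k --> \oo] --> 0.
Proof.
apply: (@cvg0_le _ (fun k => kappa / slope ^+ 2 * disp k)).
  by move=> k; rewrite res_ge0 (step_bounds k).2.
exact: cvg0Z disp_cvg0.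
Qed.

Lemma shift_cvg0 : sqn (pt k - pE k) @[k --> \oo] --> 0.
Proof.
pose A k := sqn (pE k.+1 - pE k).
have A0 : A k @[k --> \oo] --> 0.
  exact: (haugazeau_step_cvg0 hE p_next_mem dist_le_d0).
apply: (@cvg0_le _ (fun k => 2 * (disp k + A k))).
  move=> k; rewrite (form_ge0 hE) /=.
  have -> : pt k - pE k = (pt k - pE k.+1) + (pE k.+1 - pE k).
    by rewrite addrA subrK.
  by rewrite mulrDr; exact: ip_sqD_le hE _ _.
by apply: cvg0Z; apply: cvg0D A0; exact: disp_cvg0.
Qed.

Lemma wfull_le (q : prodE) j :
  inner (wfull Gs q j) (wfull Gs q j) <= n%:R * maxG2 * sqn q.
Proof.
have g0 : 0 <= maxG2 by apply: le_trans maxG2_ge1.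
have n1 : 1 <= n%:R :> R by rewrite ler1n.
have z0 : 0 <= gamma * inner q.1 q.1.
  by rewrite mulr_ge0 ?(ltW gamma_gt0) // (form_ge0 h0).
have w0 i : 0 <= inner (q.2 i) (q.2 i) by exact: form_ge0 (hS (Some i)) _.
have sw0 : 0 <= \sum_i inner (q.2 i) (q.2 i) by exact: sumr_ge0.
have hw : \sum_i inner (q.2 i) (q.2 i) <= sqn q by rewrite /ipg /form_pair lerDr.
case: j => [i|] /=.
  apply: le_trans (_ : 1 * sqn q <= _).
    rewrite mul1r; apply: le_trans hw.
    by rewrite (bigD1 i) //= lerDl; exact: sumr_ge0.
  apply: ler_wpM2r; first exact: form_ge0 hE _.
  by apply: le_trans n1 _; rewrite ler_peMr // maxG2_ge1.
rewrite (ipNl h0) (ipNr h0) opprK; apply: le_trans (sum_sq_le h0 _) _.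
rewrite card_ord -mulrA; apply: ler_pM => //.
- by apply: sumr_ge0 => i _; exact: form_ge0 h0 _.
- by rewrite ler_nat leq_pred.
apply: le_trans (ler_wpM2l g0 hw); rewrite mulr_sumr; apply: ler_sum => i _.
apply: le_trans (inner_adjoint_le_opnorm (@G_bounded (Some i)) (@Gs_adjoint (Some i)) _) _.
by rewrite ler_wpM2r ?opnorm_le_maxG2 // (form_ge0 (hS (Some i))).
Qed.

Lemma G_le (q : prodE) j :
  inner (G j q.1) (G j q.1) <= maxG2 / gamma * sqn q.
Proof.
have g0 : 0 <= maxG2 by apply: le_trans maxG2_ge1.
apply: le_trans (inner_le_opnorm (@G_bounded j) _) _.
apply: le_trans (ler_wpM2r (form_ge0 h0 _) (opnorm_le_maxG2 j)) _.
rewrite -mulrA ler_wpM2l // mulrC ler_pdivlMr // mulrC /ipg /form_pair lerDl.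
by apply: sumr_ge0 => i _; exact: form_ge0 (hS (Some i)) _.
Qed.

Lemma pt_bounded : exists D : R, forall k, sqn (pt k) <= D.
Proof.
pose O := Omega alpha beta * d0 ^+ 2.
exists (2 * O + 2 * (2 * d0 ^+ 2 + 2 * sqn (pE 0))) => k.
rewrite -[pt k](subrK (pE k.+1)); apply: le_trans (ip_sqD_le hE _ _) _.
rewrite lerD // ler_pM2l //; first exact: disp_le.
rewrite -[pE k.+1](subrK (pE 0)); apply: le_trans (ip_sqD_le hE _ _) _.
by rewrite lerD2r ler_pM2l // dist_le_d0.
Qed.

Lemma res_terms j :
  inner (y k j - wfull Gs (pt k) j) (y k j - wfull Gs (pt k) j)
    @[k --> \oo] --> 0 /\
  inner (G j (pt k).1 - x k j) (G j (pt k).1 - x k j) @[k --> \oo] --> 0.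
Proof.
have h k : 0 <= inner (y k j - wfull Gs (pt k) j) (y k j - wfull Gs (pt k) j)
     /\ 0 <= inner (G j (pt k).1 - x k j) (G j (pt k).1 - x k j)
     /\ inner (y k j - wfull Gs (pt k) j) (y k j - wfull Gs (pt k) j)
     + inner (G j (pt k).1 - x k j) (G j (pt k).1 - x k j) <= res k.
  split; first exact: form_ge0 (hS j) _.
  split; first exact: form_ge0 (hS j) _.
  rewrite /res /residual [leRHS](bigD1 j) //= lerDl; apply: sumr_ge0 => m _.
  by rewrite addr_ge0 // (form_ge0 (hS m)).
split; apply: cvg0_le res_cvg0 => k; have [h1 [h2 h3]] := h k.
  by rewrite h1 /=; apply: le_trans h3; rewrite lerDl.
by rewrite h2 /=; apply: le_trans h3; rewrite lerDr.
Qed.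

(** Write [a = G z - x] and [b = y - w] for the residuals at the extrapolated
    point.  Up to [<x - u, v - y>], which is nonpositive by monotonicity, the
    terms of [phi] there are [<v - w, a> + <G z - u, b> - <a, b>], scalar
    products of bounded sequences with null sequences.  Passing from [pt k] to
    [p k] changes the affine function by a null sequence. *)
Lemma phi_eventually_le (u v : forall j, sp H0 H j) (e : R) :
  (forall j, T (u j) (v j)) -> 0 < e ->
  exists N, forall k, (N <= k)%N -> phik u v (pE k) <= e.
Proof.
move=> Tuv e0; have [D HD] := pt_bounded.
pose gr : prodE := phi_grad G Gs gamma u v.
pose a k j := G j (pt k).1 - x k j.
pose b k j := y k j - wfull Gs (pt k) j.
pose c k j := v j - wfull Gs (pt k) j.
pose d k j := G j (pt k).1 - u j.
have c_le : exists c1 : R, forall j k, inner (c k j) (c k j) <= c1.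
  exists (2 * \sum_j inner (v j) (v j) + 2 * (n%:R * maxG2 * D)) => j k.
  rewrite /c; apply: le_trans (ip_sqD_le (hS j) _ _) _.
  rewrite (ipNl (hS j)) (ipNr (hS j)) opprK lerD // ler_pM2l //.
    rewrite [leRHS](bigD1 j) //= lerDl; apply: sumr_ge0 => m _.
    exact: form_ge0 (hS m) _.
  apply: le_trans (wfull_le _ _) _; rewrite ler_wpM2l //.
  by rewrite mulr_ge0 // (le_trans _ maxG2_ge1).
have d_le : exists d1 : R, forall j k, inner (d k j) (d k j) <= d1.
  exists (2 * (maxG2 / gamma * D) + 2 * \sum_j inner (u j) (u j)) => j k.
  rewrite /d; apply: le_trans (ip_sqD_le (hS j) _ _) _.
  rewrite (ipNl (hS j)) (ipNr (hS j)) opprK lerD // ler_pM2l //.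
    apply: le_trans (G_le _ _) _; rewrite ler_wpM2l //.
    by rewrite divr_ge0 // ?(ltW gamma_gt0) // (le_trans _ maxG2_ge1).
  rewrite [leRHS](bigD1 j) //= lerDl; apply: sumr_ge0 => m _.
  exact: form_ge0 (hS m) _.
have [c1 Hc] := c_le; have [d1 Hd] := d_le.
have lim0 j (f h : nat -> sp H0 H j) (h1 : R) :
    inner (f k) (f k) @[k --> \oo] --> 0 -> (forall k, inner (h k) (h k) <= h1) ->
    inner (h k) (f k) @[k --> \oo] --> 0.
  move=> f0 hh; apply: (@cvg0_sqr_le _ h1 _ _ _ f0) => k.
  apply: le_trans (cauchy_schwarz (hS j) _ _) _; rewrite ler_wpM2r //.
  exact: form_ge0 (hS j) _.
have a_le j k : inner (a k j) (a k j) <= kappa / slope ^+ 2 * (Omega alpha beta * d0 ^+ 2).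
  apply: le_trans (_ : kappa / slope ^+ 2 * disp k <= _); last first.
    rewrite ler_wpM2l ?disp_le // divr_ge0 ?(ltW kappa_gt0) // exprn_ge0 //.
    exact: ltW slope_gt0.
  apply: le_trans (step_bounds k).2.
  rewrite /res /residual [leRHS](bigD1 j) //= -addrA [leRHS]addrCA lerDl.
  rewrite addr_ge0 ?(form_ge0 (hS j)) //; apply: sumr_ge0 => m _.
  by rewrite addr_ge0 // (form_ge0 (hS m)).
pose w k := \sum_j (inner (c k j) (a k j) + inner (d k j) (b k j)
   - inner (a k j) (b k j)) + ip gr (pE k - pt k).
have w0 : w k @[k --> \oo] --> 0.
  apply: cvg0D.
    apply: cvg0_sum => j; have [hb ha] := res_terms j.
    apply: cvg0D; [apply: cvg0D | apply: cvg0N].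
    - exact: lim0 ha (Hc j).
    - exact: lim0 hb (Hd j).
    - exact: lim0 hb (a_le j).
  apply: (@cvg0_sqr_le _ (ip gr gr) (fun k => sqn (pt k - pE k))) shift_cvg0 => k.
  rewrite (sq_oppB hE); exact: cauchy_schwarz hE _ _.
have [N HN] := cvg0_eventually_le e0 w0; exists N => k /HN; apply: le_trans.
rewrite -(subrK (phik u v (pt k)) (phik u v (pE k))) addrC.
rewrite (phiB Gs_adjoint G_last gamma_gt0) /w lerD2r.
apply: ler_sum => j _; rewrite subr0.
have := (T_maximal j).1 _ _ _ _ (iterate_estimate k j).1 (Tuv j).
rewrite (form_sym (hS j) (c k j)) /a /b /c /d.
move: (G j (pt k).1) (x k j) (u j) (y k j) (v j) (wfull Gs (pt k) j).
move=> z x' u' y' v' w'; rewrite !(ipE (hS j)).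
lra.
Qed.

(** These sets take the place of the closed convex hulls of the tails of the
    sequence: only half-spaces given by some [phi] are needed to recognize an
    extended solution. *)
Let tail m : set prodE := [set q | forall u v : forall j, sp H0 H j,
  (forall j, T (u j) (v j)) -> forall c : R,
  (forall k, (m <= k)%N -> phik u v (pE k) <= c) -> phik u v q <= c].

Lemma tail_sub_Se (q : prodE) : (forall m, tail m q) -> Se q.
Proof.
move=> Kq; apply: (extended_of_phi_le0 T_maximal) => u v Tuv.
apply/ler_addgt0Pr => e e0; rewrite add0r.
by have [N HN] := phi_eventually_le Tuv e0; exact: Kq N u v Tuv e HN.
Qed.

Lemma tail_midconvex m : midconvex (tail m).
Proof.
move=> q1 q2 K1 K2 u v Tuv c hc.
have h1 := K1 u v Tuv c hc; have h2 := K2 u v Tuv c hc.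
have := phiB Gs_adjoint G_last gamma_gt0 u v (2^-1 *: (q1 + q2) : prodE) q1.
have := phiB Gs_adjoint G_last gamma_gt0 u v q2 q1.
rewrite mid_segment.
have -> : q1 + 2^-1 *: (q2 - q1) - q1 = 2^-1 *: (q2 - q1) by rewrite addrAC subrr add0r.
rewrite (ipZr hE) => e1 e2; move: h1 h2 e1 e2.
move: (phik u v _) (phik u v q1) (phik u v q2) (ip _ _) => ? ? ? ?; lra.
Qed.

Lemma tail_closed m : form_closed (ip := ip) (tail m).
Proof.
move=> s' l Ks sl u v Tuv c hc; apply/ler_addgt0Pr => e e0.
have := cvg0N (form_cvg_ip hE (phi_grad G Gs gamma u v) sl).
move=> /(cvg0_eventually_le e0) [N HN].
have := HN N (leqnn _); rewrite -(phiB Gs_adjoint G_last gamma_gt0).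
have := Ks N u v Tuv c hc; move: (phik u v _) (phik u v l) => ? ?; lra.
Qed.

Lemma iterates_cvg : exists2 pstar : prodE, Se pstar & form_cvg ip pE pstar.
Proof.
have [||||||q Kq qp] := nested_convex_cvg hE (K := tail) (a := pE 0)
    (D := d0 ^+ 2) (p := pE).
- move=> m k mk q Kq u v Tuv c hc; apply: Kq => // l kl; apply: hc.
  exact: leq_trans kl.
- exact: tail_midconvex.
- exact: tail_closed.
- by move=> m u v Tuv c; exact.
- exact: dist_le_d0.
- by move=> q /tail_sub_Se Sq k; exact: dist_le_Se.
by exists q => //; exact: tail_sub_Se.
Qed.

Lemma strong_convergence : exists pstar : prodsp H0 H,
     is_proj (dist_gamma gamma) Se (p 0%N) pstar /\
     dist_gamma gamma (p k) pstar @[k --> \oo] --> 0 /\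
     (p k).1 @[k --> \oo] --> pstar.1 /\
     solutions G Gs T pstar.1 /\
     (forall j, wfull Gs (p k) j @[k --> \oo] --> wfull Gs pstar j) /\
     (forall j, x k j @[k --> \oo] --> G j pstar.1) /\
     (forall j, y k j @[k --> \oo] --> wfull Gs pstar j).
Proof.
have [ps Sps ppc] := iterates_cvg; exists ps.
have g0 : 0 <= maxG2 by apply: le_trans maxG2_ge1.
have pt_cvg : form_cvg ip pt ps.
  apply: (@cvg0_le _ (fun k => 2 * (sqn (pt k - pE k) + sqn (pE k - ps)))).
    move=> k; rewrite (form_ge0 hE) /=.
    have -> : pt k - ps = (pt k - pE k) + (pE k - ps) by rewrite addrA subrK.
    by rewrite mulrDr; exact: ip_sqD_le hE _ _.
  by apply: cvg0Z; apply: cvg0D ppc; exact: shift_cvg0.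
split.
  split=> // q Sq; rewrite /dist_gamma /norm_gamma ler_wsqrtr //.
  rewrite [leLHS](sq_oppB hE) [leRHS](sq_oppB hE).
  apply/ler_addgt0Pr => e e0; have e2 : 0 < e / 2 by rewrite divr_gt0.
  have := cvg0_eventually_le e2 (cvg0N (form_cvg_ip hE (ps - pE 0) ppc)).
  move=> [N HN]; have := HN N (leqnn _).
  have := dist_le_Se N Sq; have := form_ge0 hE (pE N - ps).
  move: (sqn ((q : prodE) - pE 0)) => D; rewrite !(ipE hE).
  rewrite (form_sym hE (pE N) ps) (form_sym hE (pE N) (pE 0)) (form_sym hE (pE 0) ps).
  move: (ip _ _) (ip _ _) (ip _ _) (ip _ _) (ip _ _) (ip _ _) => *; lra.
split.
  apply: (@cvg0_sqr_le _ 1 _ _ _ ppc) => k.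
  by rewrite mul1r sqr_sqrtr // (form_ge0 hE).
split.
  apply: (@inner_cvg_le _ H0 _ _ gamma^-1 _ _ ppc) => k.
  rewrite mulrC ler_pdivlMr // mulrC /ipg /form_pair lerDl.
  by apply: sumr_ge0 => i _; exact: form_ge0 (hS (Some i)) _.
split.
  exists (wfull Gs ps); split=> //.
  exact: (sum_adjoint_wfull Gs_adjoint G_last).
split.
  move=> j; apply: (@inner_cvg_le _ _ _ _ (n%:R * maxG2) _ _ ppc) => k.
  rewrite -(wfullB Gs_adjoint); exact: wfull_le.
have sum_cvg0 (c : R) (a e : nat -> R) : a k @[k --> \oo] --> 0 ->
    e k @[k --> \oo] --> 0 -> 2 * a k + c * e k @[k --> \oo] --> 0.
  by move=> a0 e0; apply: cvg0D; exact: cvg0Z.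
split=> j; have [hb ha] := res_terms j.
  apply: (@inner_cvg_le _ _ _ _ 1 _ _ (sum_cvg0 (2 * (maxG2 / gamma)) _ _ ha pt_cvg)) => k.
  rewrite mul1r -mulrA.
  have -> : x k j - G j ps.1 = - (G j (pt k).1 - x k j) + G j (pt k - ps).1.
    by rewrite (linearB (G j)) opprB addrA subrK.
  apply: le_trans (ip_sqD_le (hS j) _ _) _.
  rewrite (ipNl (hS j)) (ipNr (hS j)) opprK lerD2l ler_pM2l //.
  exact: G_le.
apply: (@inner_cvg_le _ _ _ _ 1 _ _ (sum_cvg0 (2 * (n%:R * maxG2)) _ _ hb pt_cvg)) => k.
rewrite mul1r -mulrA.
have -> : y k j - wfull Gs ps j
    = (y k j - wfull Gs (pt k) j) + wfull Gs (pt k - ps : prodE) j.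
  by rewrite (wfullB Gs_adjoint) addrA subrK.
apply: le_trans (ip_sqD_le (hS j) _ _) _.
by rewrite lerD2l ler_pM2l // wfull_le.
Qed.

End Algorithm.

Theorem theorem4p9 (R : realType) (n : nat) (n_ge2 : (2 <= n)%N)
  (H0 : hilbertType R) (H : 'I_n.-1 -> hilbertType R)
  (H0_nontrivial : exists z : H0, z != 0)
  (domF : forall j, set (sp H0 H j)) (F : forall j, sp H0 H j -> sp H0 H j)
  (F_continuous : forall j, {within domF j, continuous (F j)})
  (F_monotone : forall j, monotone_op (single_valued (domF j) (F j)))
  (B : forall j, sp H0 H j -> set (sp H0 H j))
  (B_maximal : forall j, maximal_monotone_op (B j))
  (C : forall j, set (sp H0 H j))
  (C_nonempty : forall j, C j !=set0)
  (C_closed : forall j, closed (C j))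
  (C_convex : forall j, @convex_set R (sp H0 H j) (C j))
  (domB_sub_C : forall j, op_dom (B j) `<=` C j)
  (C_sub_domF : forall j, C j `<=` domF j)
  (G : forall j, {linear H0 -> sp H0 H j})
  (G_bounded : forall j, bounded_operator (G j))
  (Gs : forall j, sp H0 H j -> H0)
  (Gs_adjoint : forall j, is_adjoint (G j) (Gs j))
  (G_last : forall z : H0, G None z = z)
  (T := fun j => op_add (single_valued (domF j) (F j)) (B j))
  (has_solution : solutions G Gs T !=set0)
  (L : option 'I_n.-1 -> R) (L_gt0 : forall j, 0 < L j)
  (F_lipschitz : forall j, (L j).-lipschitz_(domF j) (F j))
  (sigma gamma : R) (sigma_gt0 : 0 < sigma) (sigma_lt1 : sigma < 1)
  (gamma_gt0 : 0 < gamma)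
  (alpha beta : nat -> R)
  (p : nat -> prodsp H0 H) (zbar x y : nat -> forall j, sp H0 H j)
  (algorithm : generated_sequences G Gs F B C (fun j => sigma / L j) gamma alpha beta
                 p zbar x y)
  (alpha_bounded : has_ubound (range alpha))
  (beta_summable : cvgn (series (fun k => beta k ^+ 2))) :
  let Se := extended_solutions G Gs T in
  let d0 := inf [set dist_gamma gamma (p 0%N) q | q in Se] in
  let Lmax := \big[Num.max/L None]_j L j in
  let Lmin := \big[Num.min/L None]_j L j in
  let maxG2 := \big[Num.max/opnorm (G None) ^+ 2]_j opnorm (G j) ^+ 2 in
  let rate := fun k : nat =>
    n%:R * maxG2 * Num.max (Lmax / sigma) (sigma / Lmin) * d0
      / Num.sqrt k.+1%:R in
  (exists pstar : prodsp H0 H,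
     is_proj (dist_gamma gamma) Se (p 0%N) pstar /\
     dist_gamma gamma (p k) pstar @[k --> \oo] --> 0 /\
     (p k).1 @[k --> \oo] --> pstar.1 /\
     solutions G Gs T pstar.1 /\
     (forall j, wfull Gs (p k) j @[k --> \oo] --> wfull Gs pstar j) /\
     (forall j, x k j @[k --> \oo] --> G j pstar.1) /\
     (forall j, y k j @[k --> \oo] --> wfull Gs pstar j)) /\
  (forall k : nat, exists2 l : nat, (l <= k)%N &
     (forall j, T j (x l j) (y l j)) /\
     `|\sum_(i < n.-1) Gs (Some i) (y l (Some i)) + y l None : H0|
       <= rate k * (4 * Num.sqrt gamma * Num.max 1 (1 / gamma)
                    * Num.sqrt (Omega alpha beta) / (1 - sigma ^+ 2)) /\
     (forall i : 'I_n.-1,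
        `|x l (Some i) - G (Some i) (x l None)|
          <= rate k * (4 * Num.max 1 (1 / gamma)
                       * Num.sqrt (Omega alpha beta) / (1 - sigma ^+ 2)))).
Proof.
have n_gt0 : (0 < n)%N by exact: ltnW.
split.
  exact: (strong_convergence n_gt0 H0_nontrivial F_monotone B_maximal
    C_nonempty C_closed C_convex domB_sub_C C_sub_domF G_bounded Gs_adjoint
    G_last has_solution L_gt0 F_lipschitz sigma_gt0 sigma_lt1 gamma_gt0
    algorithm alpha_bounded beta_summable).
exact: (iteration_complexity n_gt0 H0_nontrivial F_monotone B_maximal
  C_nonempty C_closed C_convex domB_sub_C C_sub_domF G_bounded Gs_adjoint
  G_last has_solution L_gt0 F_lipschitz sigma_gt0 sigma_lt1 gamma_gt0
  algorithm alpha_bounded beta_summable).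
Qed.
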